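(* Let $m\ge2$ and $S\subseteq\mathfrak{S}_{m+1}$ be such that the graph $H_S$ is ergodic. Then the operator $T$ associated with $S$ is positivity improving. In particular, $T$ has a unique eigenvalue of largest modulus, which is simple, real and positive, and the associated eigenfunction is positive.
   Context: For $x\in\mathbb{R}^n$ with distinct coordinates, $\Pi(x)\in\mathfrak{S}_n$ is the permutation with $\pi_i<\pi_j$ if and only if $x_i<x_j$. $H_S$ is the directed graph whose vertices are the points of $(0,1)^m$ with pairwise distinct coordinates. It has an edge from $(x_1,\dots,x_m)$ to $(x_2,\dots,x_{m+1})$ whenever $x_1\ne x_{m+1}$ and $\Pi(x_1,\dots,x_{m+1})\notin S$. A graph is ergodic if it is strongly connected and has period $1$, where the period is the gcd of the lengths of closed directed walks through a fixed vertex. Define $\chi$ on $[0,1]^{m+1}$ by $\chi(x)=0$ if two coordinates coincide or $\Pi(x)\in S$, and $\chi(x)=1$ otherwise. $T$ on $L^2([0,1]^m)$ is $(Tf)(x_1,\dots,x_m)=\int_0^1\chi(t,x_1,\dots,x_m)f(t,x_1,\dots,x_{m-1})\,dt$. An operator $A$ is positivity improving if for every nonzero $f\ge0$ there is $k$ with $A^kf>0$ almost everywhere. *)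

(* Defs.v *)
From HB Require Import structures.
From mathcomp Require Import all_boot all_order all_algebra fingroup perm.
From mathcomp Require Import all_classical all_reals all_analysis.
From mathcomp Require Import complex.

Set Implicit Arguments.
Unset Strict Implicit.
Unset Printing Implicit Defensive.
Import Order.TTheory GRing.Theory Num.Theory.
Import numFieldNormedType.Exports.

Local Open Scope classical_set_scope.
Local Open Scope ring_scope.
Local Open Scope complex_scope.

Section Pattern.
Context {R : realType} {n : nat}.
Implicit Type x : n.-tuple R.

Definition has_pattern x (p : 'S_n) : bool :=
  [forall i, forall j, (p i < p j)%N == (tnth x i < tnth x j)].

(* Meaningful only when the coordinates of [x] are pairwise distinct: see
   [patternP] and [pattern_unique]; otherwise no such permutation exists. *)
Definition pattern x : 'S_n := odflt 1%g [pick p | has_pattern x p].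

Let rank x (i : 'I_n) : {set 'I_n} := finset (fun j => tnth x j < tnth x i).

Lemma pattern_unique x (p q : 'S_n) :
  has_pattern x p -> has_pattern x q -> p = q.
Proof.
have rk (s : 'S_n) i : has_pattern x s -> s i = #|rank x i| :> nat.
  move=> /forallP hs.
  have -> : rank x i = s @^-1: finset (fun k : 'I_n => (k < s i)%N).
    by apply/setP => j; rewrite !inE; have /forallP/(_ i)/eqP <- := hs j.
  rewrite card_preimset; last exact: perm_inj.
  rewrite cardsE -sum1_card.
  rewrite (big_ord_narrow (F := fun=> 1%N) (ltnW (ltn_ord (s i)))).
  by rewrite sum1_card card_ord.
by move=> hp hq; apply/permP => i; apply/val_inj => /=; rewrite (rk p) ?(rk q).
Qed.

Lemma patternP x : uniq x -> has_pattern x (pattern x).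
Proof.
move=> ux.
have rk_lt i : (#|rank x i| < n)%N.
  rewrite -[ltnRHS](card_ord n) -cardsT; apply: proper_card.
  apply/properP; split; first exact: finset.subsetT.
  by exists i; rewrite ?inE ?ltxx.
have rk_mono i j : (#|rank x i| < #|rank x j|)%N = (tnth x i < tnth x j).
  have sub a b : tnth x a <= tnth x b -> rank x a \subset rank x b.
    by move=> ab; apply/fintype.subsetP => k; rewrite !inE => /lt_le_trans; apply.
  case: ltP => [ij|ji].
    apply/proper_card/properP; split; first exact/sub/ltW.
    by exists i; rewrite !inE ?ij ?ltxx.
  by rewrite ltnNge subset_leq_card // sub.
have inj : injective (fun i => Ordinal (rk_lt i)).
  move=> i j /(congr1 val) /= e; apply: (tuple_uniqP _ ux).
  by case: ltgtP (rk_mono i j) (rk_mono j i); rewrite e ltnn.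
rewrite /pattern; case: pickP => [p //|/(_ (perm inj))/negP []].
by apply/forallP => i; apply/forallP => j; rewrite !permE /= rk_mono.
Qed.

End Pattern.

Section Digraph.
Context {V : Type} (E : V -> V -> Prop).

Fixpoint walk (k : nat) (x y : V) : Prop :=
  if k is k'.+1 then exists2 z, E x z & walk k' z y else x = y.

Definition strongly_connected := forall x y, exists k, walk k x y.

(* [d] is the gcd of the lengths of the closed walks through [v]. *)
Definition is_period (v : V) (d : nat) :=
  (forall k, walk k v v -> (d %| k)%N) /\
  (forall e, (forall k, walk k v v -> (e %| k)%N) -> (e %| d)%N).

Definition ergodic := strongly_connected /\ exists v, is_period v 1%N.

End Digraph.

Section Graph.
Context {R : realType} {m : nat} (S : {set 'S_m.+1}).

Definition H_vertex :=
  {x : m.-tuple R | all (fun t => 0 < t < 1) x && uniq x}.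

(* [w] is (x_1, ..., x_(m+1)): the edge goes from its first [m] coordinates to
   its last [m] coordinates. *)
Definition H_edge (x y : H_vertex) : Prop :=
  exists w : m.+1.-tuple R,
    [/\ sval x = take m w :> seq R, sval y = behead w :> seq R,
        tnth w ord0 != tnth w ord_max & pattern w \notin S].

End Graph.

Section CubeMeasure.
Context {R : realType}.

(* [measurableTypeR R] is [R] with the measurable structure on which the
   library defines Lebesgue measure. *)
Definition tcons n (p : measurableTypeR R * n.-tuple R) : n.+1.-tuple R :=
  [tuple of p.1 :: p.2].

Lemma measurable_tcons n : measurable_fun setT (@tcons n).
Proof. exact: (measurable_cons (f := fst) (g := snd)). Qed.

HB.instance Definition _ n :=
  isMeasurableFun.Build _ _ _ _ (@tcons n) (@measurable_tcons n).

(* Lebesgue measure on the cube [0,1]^n, extended by zero to R^n: see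
   [cube_measure_box]. *)
Fixpoint cube_measure n : probability (n.-tuple R) R :=
  if n is n'.+1 then
    distribution (uniform_prob (@ltr01 R) \x cube_measure n')%E (@tcons n')
  else \d_([tuple]).

Lemma uniform_probE (A : set R) :
  measurable A ->
  uniform_prob (@ltr01 R) A = lebesgue_measure (A `&` `[0, 1]).
Proof.
move=> mA; rewrite /uniform_prob integral_uniform_pdf.
rewrite (eq_integral (cst 1%E)); last first.
  move=> x; rewrite inE /= in_itv/= => -[_ /= x01].
  by rewrite /uniform_pdf x01 subr0 invr1.
by rewrite integral_cst ?mul1e//; exact: measurableI.
Qed.

Lemma cube_measure_box n (A : 'I_n -> set R) :
  (forall i, measurable (A i)) ->
  cube_measure n [set x | forall i, A i (tnth x i)] =
  (\prod_(i < n) lebesgue_measure (A i `&` `[0%R, 1%R]))%E.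
Proof.
elim: n => [|n ih] in A * => mA.
  rewrite big_ord0 /= diracE mem_set//=; by case.
rewrite big_ord_recl /= /distribution /pushforward /=.
have -> : @tcons n @^-1` [set x | forall i, A i (tnth x i)] =
  A ord0 `*` [set x | forall i, A (lift ord0 i) (tnth x i)].
  apply/seteqP; split => -[t x] /=.
    move=> h; split; first by have := h ord0; rewrite tnth0.
    by move=> i; have := h (lift ord0 i); rewrite tnthS.
  by move=> [h0 h] i; case: (unliftP ord0 i) => [j|] -> ; rewrite ?tnthS ?tnth0.
rewrite product_measure1E//=; last first.
  rewrite (_ : [set _ | _] =
      \bigcap_(i in [set: 'I_n]) ((fun x => tnth x i) @^-1` A (lift ord0 i))).
    apply: fin_bigcap_measurable => // i _.
    by rewrite -[X in measurable X]setTI; apply: measurable_tnth.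
  by apply/seteqP; split => x h i; [move=> _; exact: h|exact: (h i I)].
  exact: mA.
by rewrite uniform_probE ?(ih (fun i => A (lift ord0 i))) //; exact: mA.
Qed.

End CubeMeasure.

Section PositivityAndSpectrum.
Context d {X : measurableType d} {R : realType}.
Variable mu : {measure set X -> \bar R}.

(* Elements of the complex space L^2(mu) are handled through representatives:
   equality in L^2 is equality mu-almost everywhere.  In the order of [R[i]],
   [0 <= z] (resp. [0 < z]) means that [z] is real and nonnegative (resp.
   positive). *)
Definition L2 (f : X -> R[i]) : Prop :=
  (fun x => complex.Re (f x)) \in Lfun mu 2%:E /\
  (fun x => complex.Im (f x)) \in Lfun mu 2%:E.

Definition ae_zero (f : X -> R[i]) : Prop := {ae mu, forall x, f x = 0}.

Variable A : (X -> R[i]) -> X -> R[i].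

Definition positivity_improving : Prop :=
  forall f, L2 f -> {ae mu, forall x, 0 <= f x} -> ~ ae_zero f ->
    exists2 k : nat, (0 < k)%N & {ae mu, forall x, 0 < iter k A f x}.

Definition is_eigenfunction (lam : R[i]) (f : X -> R[i]) : Prop :=
  [/\ L2 f, ~ ae_zero f & {ae mu, forall x, A f x = lam * f x}].

Definition is_eigenvalue (lam : R[i]) : Prop :=
  exists f, is_eigenfunction lam f.

Definition eigenvalue_of_largest_modulus (lam : R[i]) : Prop :=
  is_eigenvalue lam /\ forall nu, is_eigenvalue nu -> `|nu| <= `|lam|.

Definition generalized_eigenfunction (lam : R[i]) (f : X -> R[i]) : Prop :=
  L2 f /\
  exists k : nat, ae_zero (iter k (fun g x => A g x - lam * g x) f).

(* Algebraic multiplicity one: the generalized eigenspace is a line. *)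
Definition simple_eigenvalue (lam : R[i]) : Prop :=
  exists2 phi, is_eigenfunction lam phi &
    forall f, generalized_eigenfunction lam f ->
      exists c : R[i], {ae mu, forall x, f x = c * phi x}.

End PositivityAndSpectrum.

Section Operator.
Context {R : realType} {m : nat} (S : {set 'S_m.+1}).

Definition chi (x : m.+1.-tuple R) : R :=
  if ~~ uniq x || (pattern x \in S) then 0 else 1.

(* For x = (x_1, ..., x_m), [belast t x] is (t, x_1, ..., x_(m-1)).  The
   complex-valued integral is taken componentwise. *)
Definition T_op (f : m.-tuple R -> R[i]) (x : m.-tuple R) : R[i] :=
  (\int[lebesgue_measure]_(t in `[0, 1])
     (chi [tuple of t :: x] * complex.Re (f [tuple of belast t x]))) +i*
  (\int[lebesgue_measure]_(t in `[0, 1])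
     (chi [tuple of t :: x] * complex.Im (f [tuple of belast t x]))).

End Operator.

(* Main.v *)
Require Import Defs.
From mathcomp Require Import all_boot all_order all_algebra fingroup perm.
From mathcomp Require Import all_classical all_reals all_analysis.
From mathcomp Require Import measurable_realfun complex.
From mathcomp Require Import ring lra zify.

Set Implicit Arguments.
Unset Strict Implicit.
Unset Printing Implicit Defensive.
Import Order.TTheory GRing.Theory Num.Theory.
Import numFieldNormedType.Exports.

Local Open Scope classical_set_scope.
Local Open Scope ring_scope.
Local Open Scope complex_scope.

(** Call a sequence good if all its windows of length m+1 have distinct entries
and a pattern outside S. Then T^N f(x) is the integral of f(y_1, ..., y_m)
over those y in [0,1]^N for which (y, x) is good. For N = m + j this is an
integral operator with kernel p(t, x) = vol {z in [0,1]^j : (t, z, x) good}.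
Whether two vertices of H_S are joined by a walk of given length depends only on
the relative order of their coordinates, for which there are finitely many
possibilities; hence ergodicity gives one j that works for all pairs of
vertices. As goodness is an open condition, p > 0 almost everywhere, so T is
positivity improving.

For the spectrum put P f(x) = \int p(t, x) f(t) dt. Let r be the infimum of the
l > 0 for which some bounded f >= 0 satisfies P f + 1 <= l f. As l decreases to
r the solutions of P f + 1 = l f blow up, and normalized in L^1 they stay
uniformly bounded. The kernels p(., x) form a separable family in L^1, because
goodness is locally constant, so a subsequence converges pointwise, to an
eigenfunction phi. The transposed kernel gives an eigenfunction psi of the
adjoint, necessarily for the same eigenvalue, and phi, psi > 0. Pairing with psi
turns |nu| |f| <= P |f| into |nu| <= r, with equality only if f has constant
phase; it also excludes Jordan blocks. Since T commutes with P = T^N, all this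
passes from P to T. *)

(** * Integrable real functions on a probability space *)

(** The spectral part lives in L^1 of a probability space: kernels are bounded by 1, so P maps L^1
    into bounded functions, and L^2 enters only through its inclusion in L^1. No spectral theory of
    compact operators is used. A bounded solution of P f + 1 <= l f certifies that l lies above the
    spectral radius, and the infimum r is positive because delta u <= P u for the indicator u of a
    small box around a vertex. The eigenvalues of phi and psi agree because both compute the pairing
    of P phi with psi, and phi pairs positively with psi. The main obstacle is that T acts on
    representatives and its integral takes a default value where a slice is not integrable.
    Linearity, independence of the representative and T^N = P hold only almost everywhere, and each
    must survive a further application of T; this works because (t, x) |-> (t, x_1, ..., x_(m-1))
    preserves measure. Period 1 provides walks of every large length, so that the finitely many
    relative positions can share one length. *)

Section IntegrableReal.
Context d (X : measurableType d) (R : realType) (mu : probability X R).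
Implicit Types f g h : X -> R.

Definition intg f := mu.-integrable setT (EFin \o f).

Lemma intg_measurable f : intg f -> measurable_fun setT f.
Proof. by move=> /measurable_int/measurable_EFinP. Qed.

Lemma le_intg f g : measurable_fun setT f -> (forall x, `|f x| <= `|g x|) ->
  intg g -> intg f.
Proof.
move=> mf fg; apply: le_integrable => //; first exact/measurable_EFinP.
by move=> x _; rewrite lee_fin.
Qed.

Lemma bounded_intg f (M : R) : measurable_fun setT f ->
  (forall x, `|f x| <= M) -> intg f.
Proof.
move=> mf fM; apply: (@le_intg _ (cst M)) => //.
  by move=> x; apply: le_trans (fM x) _; exact: ler_norm.
exact: finite_measure_integrable_cst.
Qed.

Lemma intg_cst (c : R) : intg (cst c).
Proof. exact: finite_measure_integrable_cst. Qed.

Lemma intgD f g : intg f -> intg g -> intg (fun x => f x + g x).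
Proof. by move=> fi gi; exact: (integrableD _ fi gi). Qed.

Lemma intgB f g : intg f -> intg g -> intg (fun x => f x - g x).
Proof. by move=> fi gi; exact: (integrableB _ fi gi). Qed.

Lemma intgZ (c : R) f : intg f -> intg (fun x => c * f x).
Proof. by move=> fi; exact: (integrableZl _ _ fi). Qed.

Lemma intg_norm f : intg f -> intg (fun x => `|f x|).
Proof. exact: integrable_norm. Qed.

Lemma intgM_bounded h g (M : R) : measurable_fun setT h ->
  (forall x, `|h x| <= M) -> intg g -> intg (fun x => h x * g x).
Proof.
move=> mh hM gi; apply: (@le_intg _ (fun x => M * g x)); last exact: intgZ.
  by apply: measurable_funM => //; exact: intg_measurable.
move=> x; rewrite !normrM ler_wpM2r//; apply: le_trans (hM x) _.
exact: ler_norm.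
Qed.

Lemma Rintegral_ae_eq f g : intg f -> measurable_fun setT g ->
  {ae mu, forall x, f x = g x} ->
  \int[mu]_x f x = \int[mu]_x g x.
Proof.
move=> /intg_measurable mf mg fg; congr fine; apply: ae_eq_integral => //.
- exact/measurable_EFinP.
- exact/measurable_EFinP.
- by apply: filterS fg => x -> _.
Qed.

Lemma ae_eq0_Rintegral f : intg f -> {ae mu, forall x, 0 <= f x} ->
  \int[mu]_x f x <= 0 -> {ae mu, forall x, f x = 0}.
Proof.
move=> fi f0 i0; pose g x := `|f x|.
have fg : {ae mu, forall x, f x = g x}.
  by apply: filterS f0 => x f0; rewrite /g ger0_norm.
have gi : intg g by exact: intg_norm.
have i1 : \int[mu]_x g x = 0.
  apply/eqP; rewrite eq_le -{1}(Rintegral_ae_eq fi (intg_measurable gi) fg) i0.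
  by apply: Rintegral_ge0 => x _; exact: normr_ge0.
have : (\int[mu]_x `|(EFin \o f) x|)%E = 0%E.
  rewrite -[LHS]fineK; first by rewrite -[X in X%:E]/(\int[mu]_x g x) i1.
  exact: (integrable_fin_num _ gi).
have mEf : measurable_fun setT (EFin \o f) by exact/measurable_EFinP/intg_measurable.
move/(ae_eq_integral_abs mu measurableT mEf) => H.
by apply: filterS H => x /= /(_ I) [].
Qed.

Lemma ae_Rintegral_gt0 f : intg f -> {ae mu, forall x, 0 <= f x} ->
  ~ {ae mu, forall x, f x = 0} -> 0 < \int[mu]_x f x.
Proof. by move=> fi f0; apply: contra_notT; rewrite -leNgt; exact: ae_eq0_Rintegral. Qed.

Lemma Rintegral_const (c : R) : \int[mu]_x c = c.
Proof.
transitivity (c * fine (mu [set: X])); first exact: Rintegral_cst.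
by rewrite probability_setT mulr1.
Qed.

(** Scalar facts, such as the sign or the value of an eigenvalue, are read off at one point where
    several almost-everywhere identities hold together. *)
Lemma ae_exists (P : X -> Prop) : {ae mu, forall x, P x} -> exists x, P x.
Proof.
move=> aeP; apply: contrapT => /forallNP nP.
have nT : mu.-negligible [set: X].
  by apply: negligibleS aeP => x _ /=; exact: nP.
have : mu [set: X] = 0%E by exact: measure_negligible.
by rewrite probability_setT => /eqP; rewrite onee_eq0.
Qed.

Lemma not_ae_eq0_gt0 f : {ae mu, forall x, 0 < f x} -> ~ {ae mu, forall x, f x = 0}.
Proof.
move=> f0 fe0.
have [x] : exists x, 0 < f x /\ f x = 0 by apply: ae_exists; exact: filterI.
by move=> [+ fx0]; rewrite fx0 ltxx.
Qed.

End IntegrableReal.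

(** * Integral operators with bounded kernels *)

Section KernelOperator.
Context d (X : measurableType d) (R : realType) (mu : probability X R).
Variable p : X -> X -> R.
Hypothesis mp : measurable_fun setT (fun z : X * X => p z.1 z.2).
Hypothesis p01 : forall t x, 0 <= p t x <= 1.
Implicit Types f g h : X -> R.

Definition kop g x := \int[mu]_t (p t x * g t).

Let measurable_kernelr x : measurable_fun setT (p ^~ x).
Proof. exact: (measurable_fun_pair1 x mp). Qed.

Let norm_kernel t x : `|p t x| <= 1.
Proof. by case/andP: (p01 t x) => p0 p1; rewrite ger0_norm. Qed.

Lemma intg_kernel g x : intg mu g -> intg mu (fun t => p t x * g t).
Proof. by apply: intgM_bounded => // t; exact: norm_kernel. Qed.

(** The product is dominated by |f(t)| |h(x)|, whose double integral factors. This licenses Fubini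
    for signed functions: with h = 1 it gives measurability of [kop], in general the adjoint
    identity. *)
Lemma integrable_kernel_prod f h : intg mu f -> intg mu h ->
  (mu \x mu)%E.-integrable setT
    (EFin \o (fun z : X * X => p z.1 z.2 * f z.1 * h z.2)).
Proof.
move=> fi hi; have mf := intg_measurable fi; have mh := intg_measurable hi.
have mF : measurable_fun setT (fun z : X * X => p z.1 z.2 * f z.1 * h z.2).
  by apply: measurable_funM; [apply: measurable_funM => //|];
    exact: measurableT_comp.
apply/(integrable12ltyP mu mu); first exact/measurable_EFinP.
pose C := \int[mu]_x `|h x|.
have hE : (\int[mu]_x `|h x|%:E)%E = C%:E.
  by rewrite /C /Rintegral fineK//; apply: (integrable_fin_num _ (intg_norm hi)).
apply: (@le_lt_trans _ _ (\int[mu]_t (C * `|f t|)%:E)%E); last first.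
  exact: (integrable_lty _ (intgZ C (intg_norm fi))).
apply: ge0_le_integral => //.
- by move=> t _; exact: integral_ge0.
- apply: (measurable_fun_fubini_tonelli_F (abse \o (EFin \o
    (fun z : X * X => p z.1 z.2 * f z.1 * h z.2)))) => //=.
  by apply: measurableT_comp => //; exact/measurable_EFinP.
- by apply/measurable_EFinP/measurable_funM => //; apply: measurableT_comp.
move=> t _; apply: (@le_trans _ _ (\int[mu]_x (`|f t|%:E * `|h x|%:E))%E).
  apply: ge0_le_integral => //.
  - apply: measurableT_comp => //; apply/measurable_EFinP.
    exact: (measurable_fun_pair2 t mF).
  - by apply/measurable_EFinP/measurable_funM => //; apply: measurableT_comp.
  move=> x _; rewrite -EFinM lee_fin !normrM ler_wpM2r//.
  by rewrite -[leRHS]mul1r ler_wpM2r//; exact: norm_kernel.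
rewrite ge0_integralZl_EFin//; last by apply/measurable_EFinP/measurableT_comp.
by rewrite hE -EFinM mulrC.
Qed.

Lemma measurable_kop g : intg mu g -> measurable_fun setT (kop g).
Proof.
move=> gi; have := integrable_kernel_prod gi (intg_cst mu 1).
move=> /measurable_fubini_G mG.
rewrite (_ : kop g = fine \o (fubini_G mu (EFin \o
    (fun z : X * X => p z.1 z.2 * g z.1 * 1)))); last first.
  by apply/funext => x; congr fine; apply: eq_integral => t _ /=; rewrite mulr1.
exact: measurableT_comp.
Qed.

(** The L^1 to L^oo bound, from p <= 1; it turns control of an L^1 norm into a uniform bound. *)
Lemma kop_le_norm g x : intg mu g -> `|kop g x| <= \int[mu]_t `|g t|.
Proof.
move=> gi; apply: le_trans.
  by apply: le_normr_Rintegral => //; exact: intg_kernel.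
apply: le_Rintegral => //.
- exact/intg_norm/intg_kernel.
- exact: intg_norm.
- by move=> t _; rewrite normrM -[leRHS]mul1r ler_wpM2r//; exact: norm_kernel.
Qed.

Lemma intg_kop g : intg mu g -> intg mu (kop g).
Proof.
move=> gi; apply: bounded_intg; first exact: measurable_kop.
by move=> x; exact: kop_le_norm.
Qed.

Lemma kopD f g x : intg mu f -> intg mu g ->
  kop (fun t => f t + g t) x = kop f x + kop g x.
Proof.
move=> fi gi; rewrite /kop -RintegralD//; try exact: intg_kernel.
by apply: eq_Rintegral => t _; rewrite mulrDr.
Qed.

Lemma kopB f g x : intg mu f -> intg mu g ->
  kop (fun t => f t - g t) x = kop f x - kop g x.
Proof.
move=> fi gi; rewrite /kop -RintegralB//; try exact: intg_kernel.
by apply: eq_Rintegral => t _; rewrite mulrBr.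
Qed.

Lemma kopZ (c : R) f x : intg mu f -> kop (fun t => c * f t) x = c * kop f x.
Proof.
move=> fi; rewrite /kop -RintegralZl//; try exact: intg_kernel.
by apply: eq_Rintegral => t _; rewrite mulrCA.
Qed.

Lemma le_kop f g x : intg mu f -> intg mu g -> (forall t, f t <= g t) ->
  kop f x <= kop g x.
Proof.
move=> fi gi fg; apply: le_Rintegral => //; try exact: intg_kernel.
by move=> t _; rewrite ler_wpM2l//; case/andP: (p01 t x).
Qed.

Lemma kop_ge0 f x : (forall t, 0 <= f t) -> 0 <= kop f x.
Proof.
move=> f0; apply: Rintegral_ge0 => t _; rewrite mulr_ge0//.
by case/andP: (p01 t x).
Qed.

Lemma kop_ae_eq f g x : intg mu f -> intg mu g ->
  {ae mu, forall t, f t = g t} -> kop f x = kop g x.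
Proof.
move=> fi gi fg; apply: Rintegral_ae_eq; first exact: intg_kernel.
- exact/intg_measurable/intg_kernel.
- by apply: filterS fg => t ->.
Qed.

Lemma kop_gt0 f x : intg mu f -> {ae mu, forall t, 0 <= f t} ->
  ~ {ae mu, forall t, f t = 0} -> {ae mu, forall t, 0 < p t x} -> 0 < kop f x.
Proof.
move=> fi f0 fn0 px0; apply: ae_Rintegral_gt0; first exact: intg_kernel.
- by apply: filterS2 f0 px0 => t ft0 pt0; rewrite mulr_ge0// ltW.
- move=> pf0; apply: fn0; apply: filterS2 px0 pf0 => t pt0 /eqP.
  by rewrite mulf_eq0 gt_eqF//= => /eqP.
Qed.

End KernelOperator.

Section KernelDuality.
Context d (X : measurableType d) (R : realType) (mu : probability X R).
Variable p : X -> X -> R.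
Hypothesis mp : measurable_fun setT (fun z : X * X => p z.1 z.2).
Hypothesis p01 : forall t x, 0 <= p t x <= 1.

Lemma kop_adjoint (f h : X -> R) : intg mu f -> intg mu h ->
  \int[mu]_x (kop mu p f x * h x) =
  \int[mu]_t (f t * kop mu (fun x t => p t x) h t).
Proof.
move=> fi hi; have Fi := integrable_kernel_prod mp p01 fi hi.
have mpT : measurable_fun setT (fun z : X * X => p z.2 z.1).
  exact: (measurableT_comp mp (@measurable_swap _ _ X X)).
have pT01 (x t : X) : 0 <= p t x <= 1 by [].
have hk t : intg mu (fun x => p t x * h x) by exact: (intg_kernel mpT pT01 t hi).
have fk x : intg mu (fun t => p t x * f t) by exact: (intg_kernel mp p01 x fi).
have FE := Fubini Fi; apply/esym.
transitivity (fine (\int[mu]_t \int[mu]_x (p t x * f t * h x)%:E)%E).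
  congr fine; apply: eq_integral => t _.
  rewrite /kop -RintegralZl//; last exact: hk.
  rewrite /Rintegral fineK; last exact: (integrable_fin_num _ (intgZ (f t) (hk t))).
  by apply: eq_integral => x _; congr EFin; rewrite mulrCA mulrA.
rewrite FE; congr fine; apply: eq_integral => x _.
rewrite /kop mulrC -RintegralZl//; last exact: fk.
rewrite /Rintegral fineK; last exact: (integrable_fin_num _ (intgZ (h x) (fk x))).
by apply: eq_integral => t _ /=; congr EFin; rewrite mulrC.
Qed.

End KernelDuality.

(** * Existence of a Perron eigenfunction *)

Lemma cvg_Rintegral_bounded d (X : measurableType d) (R : realType)
    (mu : probability X R) (h_ : nat -> X -> R) (h : X -> R) (M : R) :
  (forall n, measurable_fun setT (h_ n)) -> measurable_fun setT h ->
  (forall n x, `|h_ n x| <= M) ->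
  {ae mu, forall x, h_ n x @[n --> \oo] --> h x} ->
  \int[mu]_x h_ n x @[n --> \oo] --> \int[mu]_x h x.
Proof.
move=> mh_ mh hM cvgh.
have [] := @dominated_convergence _ X R mu setT measurableT
  (fun n => EFin \o h_ n) (EFin \o h) (EFin \o cst M).
- by move=> n; exact/measurable_EFinP.
- exact/measurable_EFinP.
- by apply: filterS cvgh => x hx _; apply/fine_cvgP; split; [exact: nearW|exact: hx].
- exact: intg_cst.
- by apply: aeW => x n _; rewrite lee_fin.
move=> hi _ cvgI; apply: fine_cvg; rewrite fineK//.
exact: (integrable_fin_num _ hi).
Qed.

Section PerronEigenfunction.
Context d (X : measurableType d) (R : realType) (mu : probability X R).
Variable p : X -> X -> R.
Hypothesis mp : measurable_fun setT (fun z : X * X => p z.1 z.2).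
Hypothesis p01 : forall t x, 0 <= p t x <= 1.

Local Notation P := (kop mu p).
Local Notation mfun f := (measurable_fun [set: X] f).

Let eqW (a b : R) : a = b -> a <= b. Proof. by move=> ->. Qed.

Let bnd_intg (f : X -> R) M : mfun f -> (forall x, 0 <= f x <= M) -> intg mu f.
Proof.
move=> mf fM; apply: (@bounded_intg _ _ _ mu f M) => // x.
by case/andP: (fM x) => f0 f1; rewrite ger0_norm.
Qed.

Lemma cvg_kop (h_ : nat -> X -> R) (h : X -> R) (M : R) x :
  (forall n, mfun (h_ n)) -> mfun h -> (forall n x, `|h_ n x| <= M) ->
  {ae mu, forall x, h_ n x @[n --> \oo] --> h x} ->
  P (h_ n) x @[n --> \oo] --> P h x.
Proof.
move=> mh_ mh hM cvgh.
have mpx : mfun (p ^~ x) by exact: (measurable_fun_pair1 x mp).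
apply: (@cvg_Rintegral_bounded _ _ _ _ (fun n t => p t x * h_ n t) _ M).
- by move=> n; exact: measurable_funM.
- exact: measurable_funM.
- move=> n t; rewrite normrM -[leRHS]mul1r ler_pM//.
  by case/andP: (p01 t x) => p0 p1; rewrite ger0_norm.
- by apply: filterS cvgh => t; exact: cvgMr.
Qed.

(** For l above the spectral radius, (l - P)^-1 applied to 1 is such a function with equality. The
    existence of [f] thus serves as an elementary substitute for [l] exceeding the spectral
    radius. *)
Definition supersolution (l : R) (f : X -> R) M :=
  [/\ mfun f, forall x, 0 <= f x <= M & forall x, P f x + 1 <= l * f x].

Lemma supersolution_two : supersolution 2 (cst 1) 1.
Proof.
split=> // [x|x]; first by rewrite ler01 lexx.
rewrite mulr1 -[leRHS]/(1 + 1) lerD2r.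
apply: le_trans (ler_norm _) _; apply: le_trans.
  exact: (kop_le_norm mp p01 x (intg_cst mu 1)).
under eq_Rintegral do rewrite /= normr1.
by rewrite Rintegral_const.
Qed.

Lemma supersolution_ge l f M x : supersolution l f M -> 1 <= l * f x.
Proof.
move=> [mf f0 fl]; apply: le_trans (fl x); rewrite lerDr.
by apply: (@kop_ge0 _ _ _ mu p p01) => // t; case/andP: (f0 t).
Qed.

Lemma supersolution_gt0 l f M (x : X) : supersolution l f M -> 0 < l /\ 0 < M.
Proof.
move=> sf; have lf := supersolution_ge x sf; case: sf => mf /(_ x)/andP[f0 fM] _.
have f1 : 0 < f x.
  by rewrite lt_neqAle f0 andbT; apply: contraTneq lf => <-; rewrite mulr0 -ltNge.
split; last exact: lt_le_trans fM.
by rewrite -(pmulr_lgt0 _ f1); apply: lt_le_trans lf.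
Qed.

(** Doubling [f] doubles the added constant: P (2 f) + 2 <= l (2 f). The spare 1 absorbs (2 M)^-1 (2
    f), which is at most 1. *)
Lemma supersolution_open l f M (x : X) : supersolution l f M ->
  supersolution (l - (2 * M)^-1) (fun x => 2 * f x) (2 * M).
Proof.
move=> sf; have [l0 M0] := supersolution_gt0 x sf; case: sf => mf f0 fl.
split=> [|t|t].
- exact: measurable_funM.
- by case/andP: (f0 t) => ? ?; rewrite mulr_ge0//= ler_pM2l.
rewrite (kopZ mp p01)//; last exact: bnd_intg mf f0.
have /andP[ft0 ftM] := f0 t.
have : (2 * M)^-1 * (2 * f t) <= 1.
  by rewrite mulrC ler_pdivrMr ?mulr_gt0// mul1r ler_pM2l.
by move: (fl t) => H1 H2; lra.
Qed.

(** Iterating f >= (P f) / l from f >= u / l gives f >= (delta / l)^n u / l, which is unbounded at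
    [x0] if l < delta. This keeps the critical value away from 0. *)
Lemma supersolution_lower (u : X -> R) (delta : R) (x0 : X) l f M :
  mfun u -> (forall x, 0 <= u x <= 1) -> 0 < u x0 -> 0 < delta ->
  (forall x, delta * u x <= P u x) ->
  supersolution l f M -> delta <= l.
Proof.
move=> mu_ u01 ux0 d0 Pu sf; have [l0 M0] := supersolution_gt0 x0 sf.
rewrite leNgt; apply/negP => ld.
have ui := bnd_intg mu_ u01.
have fge n x : (delta / l) ^+ n / l * u x <= f x.
  elim: n x => [|n IH] x.
    rewrite expr0 mul1r ler_pdivrMl//; apply: le_trans (supersolution_ge x sf).
    by case/andP: (u01 x).
  case: sf => mf f0 fl; rewrite -(ler_pM2l l0); apply: le_trans (fl x).
  apply: (@le_trans _ _ (P f x)); last by rewrite lerDl.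
  apply: (@le_trans _ _ (P (fun x => (delta / l) ^+ n / l * u x) x)); last first.
    apply: (le_kop mp p01) => //; [exact: intgZ|exact: bnd_intg mf f0].
  rewrite (kopZ mp p01)//; apply: (@le_trans _ _
    ((delta / l) ^+ n / l * (delta * u x))); last first.
    by rewrite ler_wpM2l// mulr_ge0 ?invr_ge0 ?exprn_ge0 ?divr_ge0// ltW.
  rewrite exprS; apply: eqW; field; exact/lt0r_neq0.
pose z := l / delta.
have z1 : `|z| < 1 by rewrite ger0_norm ?divr_ge0 ?ltW// ltr_pdivrMr// mul1r.
(* Once (l / delta)^n falls below this threshold, the lower bound for [f x0] exceeds [M]. *)
have /cvgrPdist_lt/(_ (u x0 / l / M)) := cvg_expr z1.
case; first by rewrite !divr_gt0.
move=> n _ /(_ n (leqnn n)) /=; rewrite sub0r normrN ger0_norm; last first.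
  by rewrite exprn_ge0// divr_ge0// ltW.
rewrite ltNge => /negP; apply.
rewrite ler_pdivrMr// /z -[l / delta]invf_div exprVn ler_pdivlMl; last first.
  by rewrite exprn_gt0// divr_gt0.
apply: le_trans (le_trans (fge n x0) _).
  by apply: eqW; field; rewrite !lt0r_neq0.
by case: sf => _ /(_ x0)/andP[].
Qed.

(* The iteration [f |-> (P f + 1) / l] decreases from the supersolution. *)
Lemma supersolution_solution l f M (x : X) : supersolution l f M ->
  exists g : X -> R, [/\ mfun g, forall x, 0 <= g x <= M & forall x, P g x + 1 = l * g x].
Proof.
move=> sf; have [l0 M0] := supersolution_gt0 x sf.
case: sf => mf f0 fl.
pose F (g : X -> R) x := (P g x + 1) / l.
pose s n := iter n F f.
have sP n : [/\ mfun (s n), forall x, 0 <= s n x <= M & forall x, F (s n) x <= s n x].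
  elim: n => [|n [ms s0 sF]].
    by split=> // t; rewrite /F ler_pdivrMr// mulrC.
  have si := bnd_intg ms s0.
  have sS t : 0 <= s n.+1 t <= M.
    apply/andP; split; last by apply: le_trans (sF t) _; case/andP: (s0 t).
    rewrite /s /= /F divr_ge0 ?(ltW l0)// addr_ge0//.
    by apply: (@kop_ge0 _ _ _ mu p p01) => // y; case/andP: (s0 y).
  have mS : mfun (s n.+1).
    by apply: measurable_funM => //; apply: measurable_funD => //;
      exact: measurable_kop.
  split=> // t; rewrite [leRHS]/s /= /F ler_pM2r ?invr_gt0// lerD2r.
  apply: (le_kop mp p01) => //; exact: bnd_intg mS sS.
pose g x := limn (s ^~ x).
have sg y : s n y @[n --> \oo] --> g y.
  apply: nonincreasing_is_cvgn.
    apply/nonincreasing_seqP => n; rewrite /s iterS; by case: (sP n).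
  by exists 0 => _ [n _ <-]; case: (sP n) => _ /(_ y)/andP[].
have mg : mfun g.
  by apply: (measurable_fun_cvg (h := s)) => [n|y _]; [case: (sP n)|exact: sg].
exists g; split=> // y.
  apply/andP; split.
    apply: limr_ge; first exact: cvgP (sg y).
    by apply: nearW => n; case: (sP n) => _ /(_ y)/andP[].
  apply: limr_le; first exact: cvgP (sg y).
  by apply: nearW => n; case: (sP n) => _ /(_ y)/andP[].
have cP : P (s n) y @[n --> \oo] --> P g y.
  apply: (@cvg_kop _ _ M) => //; first by move=> n; case: (sP n).
    by move=> n t; case: (sP n) => _ /(_ t)/andP[? ?] _; rewrite ger0_norm.
  exact: aeW.
have c1 : F (s n) y @[n --> \oo] --> F g y.
  by apply: cvgM; [apply: cvgD => //; exact: cvg_cst|exact: cvg_cst].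
have c2 : F (s n) y @[n --> \oo] --> g y.
  have := sg y; rewrite -(cvg_shiftS (s ^~ y)).
  by [].
have := cvg_unique _ c1 c2; rewrite /F => /(_ (@Rhausdorff _)) E.
by rewrite -E mulrC divfK// gt_eqF.
Qed.

End PerronEigenfunction.

(** * Passing to the limit at the critical value *)

Section PerronLimit.
Context d (X : measurableType d) (R : realType) (mu : probability X R).
Variable p : X -> X -> R.
Hypothesis mp : measurable_fun setT (fun z : X * X => p z.1 z.2).
Hypothesis p01 : forall t x, 0 <= p t x <= 1.

Local Notation P := (kop mu p).
Local Notation mfun f := (measurable_fun [set: X] f).

Variables (u : X -> R) (delta : R) (x0 : X).
Hypotheses (mu_ : mfun u) (u01 : forall x, 0 <= u x <= 1) (ux0 : 0 < u x0).
Hypotheses (delta_gt0 : 0 < delta) (Pu : forall x, delta * u x <= P u x).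

Let L := [set l : R | exists f M, supersolution mu p l f M].

Let L_ge l : L l -> delta <= l.
Proof.
by move=> [f [M sf]]; exact: (supersolution_lower mp p01 mu_ u01 ux0 delta_gt0 Pu sf).
Qed.

Let L_inf : has_inf L.
Proof.
split; last by exists delta => l /L_ge.
by exists 2; exists (cst 1), 1; exact: supersolution_two.
Qed.

Let r := inf L.

Let r_ge : delta <= r.
Proof. by apply: lb_le_inf; [case: L_inf|move=> l /L_ge]. Qed.

Let intg01 (g : X -> R) C : mfun g -> (forall x, 0 <= g x <= C) -> intg mu g.
Proof.
move=> mg gC; apply: (@bounded_intg _ _ _ mu g C) => // x.
by case/andP: (gC x) => g0 g1; rewrite ger0_norm.
Qed.

Let kop_le_int (g : X -> R) x : intg mu g -> (forall x, 0 <= g x) ->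
  P g x <= \int[mu]_x g x.
Proof.
move=> gi g0; apply: le_trans (ler_norm _) _; apply: le_trans.
  exact: (kop_le_norm mp p01 x gi).
by under eq_Rintegral do rewrite ger0_norm//.
Qed.

(* Near the critical value [r] the solutions of [P f + 1 = l f] blow up; as
   [P] maps L^1 boundedly to L^oo their L^1 norms do too, so that normalizing
   in L^1 keeps the solutions uniformly bounded. *)
Lemma approximate_eigenfunction (eta : R) : 0 < eta ->
  exists (g : X -> R) (l e : R), [/\ mfun g, forall x, 0 <= g x <= 2 / delta,
    \int[mu]_x g x = 1, r <= l <= r + eta &
    0 <= e <= eta /\ forall x, P g x + e = l * g x].
Proof.
wlog eta1 : eta / eta <= 1.
  move=> H eta0; have [eta1|eta1] := leP eta 1; first exact: H.
  have [//|//|g [l [e [? ? ? /andP[? ?] [/andP[? ?] ?]]]]] := H 1.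
  exists g, l, e; split => //; last split => //; apply/andP; split=> //; lra.
(* With l >= delta, the gap l / (2 (s + 1)) < eta' found below yields s + 1 > 2 / eta, hence s >= 1
   / eta because eta <= 1. *)
move=> eta0; pose eta' := delta * eta / 4.
have eta'0 : 0 < eta' by rewrite /eta' !mulr_gt0// invr_gt0.
have [l [f0 [M0 sf0]] lr] := inf_adherent eta'0 L_inf.
have [f [mf f01 fE]] := supersolution_solution mp p01 x0 sf0.
have l_ge : delta <= l by apply: L_ge; exists f0, M0.
have l0 : 0 < l by exact: lt_le_trans l_ge.
have fi := intg01 mf f01.
have f_ge0 x : 0 <= f x by case/andP: (f01 x).
pose s := \int[mu]_x f x.
have s0 : 0 <= s by apply: Rintegral_ge0 => x _.
have fM x : f x <= (s + 1) / l.
  by rewrite ler_pdivlMr// mulrC -fE lerD2r; exact: kop_le_int.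
have sf : supersolution mu p l f ((s + 1) / l).
  split=> // x; first by rewrite f_ge0 fM.
  by rewrite fE.
(* Openness, used with the bound (s + 1) / l, puts r at least l / (2 (s + 1)) below l. As l is
   within eta' of r, the L^1 norm s must be large. *)
have := supersolution_open mp p01 x0 sf => sf'.
have : r <= l - (2 * ((s + 1) / l))^-1.
  apply: ge_inf; first by case: L_inf.
  by eexists; eexists; exact: sf'.
have -> : (2 * ((s + 1) / l))^-1 = l / (2 * (s + 1)).
  by field; rewrite !gt_eqF// ltr_wpDl.
move=> rl.
have s1 : eta^-1 <= s.
  have : l / (2 * (s + 1)) < eta' by move: rl lr; rewrite -/r; lra.
  rewrite ltr_pdivrMr ?mulr_gt0// ?ltr_wpDl// /eta'.
  move=> H; have : delta < delta * (eta * (s + 1) / 2).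
    by apply: le_lt_trans l_ge (lt_le_trans H _); lra.
  rewrite -[ltLHS]mulr1 ltr_pM2l// => H2.
  rewrite -[eta^-1]mul1r ler_pdivrMr// mulrC; lra.
have s_gt0 : 0 < s by apply: lt_le_trans s1; rewrite invr_gt0.
have se : s^-1 <= eta by rewrite invf_ple.
exists (fun x => s^-1 * f x), l, s^-1; split.
- exact: measurable_funM.
- move=> x; rewrite mulr_ge0 ?invr_ge0//=.
  (* The bound 2 / delta comes from (s + 1) / (s l) with s >= 1 and l >= delta; it does not depend
     on eta. *)
  rewrite mulrC ler_pdivrMr//; apply: le_trans (fM x) _.
  rewrite ler_pdivrMr//.
  have : 1 <= s by apply: le_trans s1; rewrite invf_ge1.
  move=> s1'; apply: (@le_trans _ _ (2 * s)); first by lra.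
  rewrite -[leLHS]mulr1 -!mulrA ler_pM2l// [_ * (s * _)]mulrCA ler_pM2l//.
  by rewrite mulrC ler_pdivlMr// mul1r.
- by rewrite RintegralZl// -/s mulVf// gt_eqF.
- apply/andP; split; first by apply: ge_inf; [case: L_inf|exists f0, M0].
  apply: le_trans (ltW lr) _; rewrite lerD2l.
  have : delta <= 2.
    apply: L_ge; exists (cst 1), 1; exact: supersolution_two.
  by rewrite /eta' => d2; nra.
split=> [|x]; first by rewrite invr_ge0 s0 se.
by rewrite (kopZ mp p01)// -{2}[s^-1]mulr1 -mulrDr fE mulrCA.
Qed.

Variables (V : set X) (D : nat -> X).
Hypothesis aeV : {ae mu, forall x, V x}.
(** This replaces compactness of P: uniformly over the unit interval of functions, values of P g at
    points of [V] are approximated by values at countably many points. *)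
Hypothesis sep : forall x, V x -> forall e : R, 0 < e -> exists j,
  forall g : X -> R, mfun g -> (forall t, 0 <= g t <= 1) -> `|P g x - P g (D j)| <= e.

(** A diagonal subsequence without nested extractions: a single ultrafilter refining the filter at
    infinity makes every coordinate converge in the compact [0, C], and [n_ k] is then picked to be
    good for the first k coordinates. *)
Let cluster_points (G : nat -> nat -> R) (C : R) :
  (forall n j, 0 <= G n j <= C) -> exists n_ : nat -> nat, exists z : nat -> R,
  forall k j, (j < k)%N -> `|G (n_ k) j - z j| <= k.+1%:R^-1 /\ (k <= n_ k)%N.
Proof.
move=> GC; have [U [UU sU]] := @ultraFilterLemma _ (\oo : set_system nat) _.
have [z zP] : exists z : nat -> R, forall j, G n j @[n --> U] --> z j.
  suff /choice[z zP] : forall j, exists z : R, G n j @[n --> U] --> z by exists z.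
  move=> j.
  pose W := (fun n => G n j) @ U.
  have WU : UltraFilter W.
    apply: Build_UltraFilter => H HP WH; apply/seteqP; split => // A HA.
    have [//|UA] := in_ultra_setVsetC ((fun n => G n j) @^-1` A) UU.
    have /(filterI HA) : H (~` A) by apply: WH; rewrite /W /=.
    by rewrite setICr => /filter_not_empty.
  have := @segment_compact R 0 C; rewrite compact_ultra => /(_ W WU).
  move=> [|z [_ Wz]]; last by exists z.
  rewrite /W /=; apply: filterS (@filterT _ U _) => n _ /=.
  by rewrite in_itv /=.
have n_P k : exists n, forall j, (j < k)%N ->
    `|G n j - z j| <= k.+1%:R^-1 /\ (k <= n)%N.
  have : U [set n | (forall j : 'I_k, `|z j - G n j| <= k.+1%:R^-1) /\ (k <= n)%N].
    apply: filterI; last by apply: sU; exists k.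
    apply: filter_forall => j; have /cvgrPdist_le := zP j; apply.
    by rewrite invr_gt0.
  move=> /filter_ex[n [H kn]]; exists n => j jk; split => //.
  by rewrite distrC; have := H (Ordinal jk).
have [n_ n_H] := choice n_P.
by exists n_, z => k j jk; exact: n_H.
Qed.

Lemma perron_eigenfunction : exists (rho C : R) (phi : X -> R),
  [/\ 0 < rho, mfun phi, forall x, 0 <= phi x <= C, \int[mu]_x phi x = 1 &
      {ae mu, forall x, P phi x = rho * phi x}].
Proof.
have inv0 n : 0 < n.+1%:R^-1 :> R by rewrite invr_gt0.
have r0 : 0 < r by exact: lt_le_trans r_ge.
have [g] := choice (fun n => approximate_eigenfunction (inv0 n)).
move=> /choice[l] /choice[e] gP.
pose C := 2 / delta; have C0 : 0 < C by rewrite divr_gt0.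
have PgC n j : 0 <= P (g n) (D j) <= 1.
  have [mg gC g1 _ _] := gP n; rewrite -g1; apply/andP; split.
    by apply: (@kop_ge0 _ _ _ mu p p01) => t; case/andP: (gC t).
  apply: kop_le_int; first exact: intg01 mg gC.
  by move=> t; case/andP: (gC t).
have [n_ [z n_P]] := cluster_points PgC.
pose h k := g (n_ k).
have mh k : mfun (h k) by rewrite /h; case: (gP (n_ k)).
have hC k x : 0 <= h k x <= C by rewrite /h; case: (gP (n_ k)).
have Pcvg x : V x -> cvgn (fun k => P (h k) x).
  (* [P (h k) x] is within eps / 4 of [P (h k) (D j)] for all k at once, since C^-1 h k has values
     in [0, 1]; the latter sequence tends to [z j]. *)
  move=> Vx; apply/cauchy_cvgP/cauchy_exP => eps eps0.
  have [|j jP] := sep Vx (e := eps / 4 / C); first by rewrite !divr_gt0.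
  exists (z j); have := near_infty_natSinv_lt (PosNum (divr_gt0 eps0 (ltr0n _ 4))).
  move=> near1; suff : \forall k \near \oo, ball (z j) eps (P (h k) x) by [].
  near=> k; rewrite /ball /= distrC.
  have kj : (j < k)%N by near: k; exact: nbhs_infty_gt.
  have [H1 _] := n_P k j kj.
  have H2 : k.+1%:R^-1 < eps / 4 by near: k.
  have H3 : `|P (h k) x - P (h k) (D j)| <= eps / 4.
    have := jP (fun t => C^-1 * h k t); rewrite !(kopZ mp p01); try exact: intg01 (mh k) (hC k).
    rewrite -mulrBr normrM (gtr0_norm (x:=C^-1)) ?invr_gt0//.
    rewrite [leRHS]mulrC ler_pM2l ?invr_gt0//; apply; first exact: measurable_funM.
    move=> t; have /andP[h0 h1] := hC k t; apply/andP; split.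
      by rewrite mulr_ge0// invr_ge0 ltW.
    by rewrite ler_pdivrMl// mulr1.
  have -> : P (h k) x - z j = (P (h k) x - P (h k) (D j)) + (P (h k) (D j) - z j) by ring.
  apply: le_lt_trans (ler_normD _ _) _; apply: le_lt_trans (lerD H3 H1) _.
  have Q (a b : R) : 0 < b -> a < b / 4 -> b / 4 + a < b by move=> ? ?; lra.
  exact: Q.
have cvg_inv : (k.+1%:R^-1 : R) @[k --> \oo] --> (0 : R) by exact: cvg_harmonic.
(* [n_P] gives k <= n_ k only together with some j < k, hence the restriction to k > 0. *)
have nk k : (0 < k)%N -> (n_ k).+1%:R^-1 <= k.+1%:R^-1 :> R.
  move=> k0; rewrite lef_pV2 ?posrE// ler_nat ltnS.
  by have [] := n_P k 0%N k0.
have lcvg : l (n_ k) @[k --> \oo] --> r.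
  apply: (@squeeze_cvgr _ _ _ _ (cst r) (fun k => r + k.+1%:R^-1)).
  - near=> k; have [_ _ _ /andP[l1 l2] _] := gP (n_ k).
    rewrite l1 /=; apply: le_trans l2 _; rewrite lerD2l; apply: nk.
    by near: k; exact: nbhs_infty_gt.
  - exact: cvg_cst.
  - by rewrite -[X in _ --> X]addr0; apply: cvgD => //; exact: cvg_cst.
have ecvg : e (n_ k) @[k --> \oo] --> (0 : R).
  apply: (@squeeze_cvgr _ _ _ _ (cst 0) (fun k => k.+1%:R^-1)) => //.
  - near=> k; have [_ _ _ _ [/andP[l1 l2] _]] := gP (n_ k).
    rewrite l1 /=; apply: le_trans l2 _; apply: nk.
    by near: k; exact: nbhs_infty_gt.
  - exact: cvg_cst.
(* The approximate eigenvalue equation expresses [h] through [P h], so convergence of [P h] carries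
   over to [h]. *)
have hE k x : h k x = (P (h k) x + e (n_ k)) / l (n_ k).
  have [_ _ _ /andP[l1 _] [_ ->]] := gP (n_ k).
  by rewrite mulrC mulKf// gt_eqF//; exact: lt_le_trans l1.
have hcvg x : V x -> h k x @[k --> \oo] --> (limn (fun k => P (h k) x) + 0) / r.
  move=> Vx; under eq_cvg do rewrite hE.
  apply: cvgM; first by apply: cvgD => //; exact: Pcvg.
  by apply: cvgV => //; rewrite gt_eqF.
have [N [mN N0 NV]] := aeV.
have VN x : ~ N x -> V x by move=> nNx; apply: contrapT => nVx; apply: nNx; exact: NV.
(* Zeroing [h] on a null set makes it converge everywhere, so that the limit is measurable. *)
pose h' k x := \1_(~` N) x * h k x.
have mh' k : mfun (h' k).
  by apply: measurable_funM => //; apply: measurable_indic; exact: measurableC.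
have h'C k x : 0 <= h' k x <= C.
  have /andP[h0 h1] := hC k x; rewrite /h' indicE.
  by case: (x \in _); rewrite ?mul1r ?mul0r ?lexx ?h0 ?h1 ?(ltW C0).
pose phi x := limn (h' ^~ x).
have h'phi x : h' k x @[k --> \oo] --> phi x.
  have [Nx|nNx] := pselect (N x).
    have H0 : h' k x @[k --> \oo] --> (0 : R).
      rewrite /h' indicE memNset/=; last by move=> /(_ Nx).
      by under eq_cvg do rewrite mul0r; exact: cvg_cst.
    exact: cvgP H0.
  have H1 : h' k x @[k --> \oo] --> (limn (fun k => P (h k) x) + 0) / r.
    rewrite /h' indicE mem_set//=; under eq_cvg do rewrite mul1r.
    exact: hcvg (VN _ nNx).
  exact: cvgP H1.
have mphi : mfun phi.
  by apply: (measurable_fun_cvg (h := h')) => [n|y _]; [exact: mh'|exact: h'phi].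
have phiC x : 0 <= phi x <= C.
  apply/andP; split.
    by apply: limr_ge; [exact: cvgP (h'phi x)|apply: nearW => n; case/andP: (h'C n x)].
  by apply: limr_le; [exact: cvgP (h'phi x)|apply: nearW => n; case/andP: (h'C n x)].
have aeN : {ae mu, forall x, ~ N x}.
  by exists N; split => // x /=; apply: contrapT.
have aehphi : {ae mu, forall x, h k x @[k --> \oo] --> phi x}.
  apply: filterS aeN => x nNx; have := h'phi x.
  by rewrite /h' indicE mem_set//=; under eq_cvg do rewrite mul1r.
have hn k x : `|h k x| <= C by have /andP[? ?] := hC k x; rewrite ger0_norm.
exists r, C, phi; split => //.
  have := cvg_Rintegral_bounded mh mphi hn aehphi.
  rewrite (_ : (fun n => _) = cst (1 : R)); last first.
    by apply/funext => k; rewrite /h; case: (gP (n_ k)).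
  move=> c1; exact: (cvg_unique (@Rhausdorff R) c1 (cvg_cst (1 : R))).
apply: (filterS _ aehphi) => x hx.
have cP : P (h k) x @[k --> \oo] --> P phi x by exact: (cvg_kop mp p01 mh mphi hn aehphi).
have c1 : P (h k) x @[k --> \oo] --> r * phi x.
  have -> : (fun k => P (h k) x) = (fun k => l (n_ k) * h k x - e (n_ k)).
    by apply/funext => k; have [_ _ _ _ [_ <-]] := gP (n_ k); rewrite addrK.
  rewrite -[X in _ --> X]subr0; apply: cvgB => //; exact: cvgM.
exact: (cvg_unique (@Rhausdorff _) cP c1).
Unshelve. all: by end_near. Qed.

End PerronLimit.

(** * Uniqueness *)

Section Jentzsch.
Context d (X : measurableType d) (R : realType) (mu : probability X R).
Variable p : X -> X -> R.
Hypothesis mp : measurable_fun setT (fun z : X * X => p z.1 z.2).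
Hypothesis p01 : forall t x, 0 <= p t x <= 1.
Variable V : set X.
Hypothesis aeV : {ae mu, forall x, V x}.
Hypothesis p_gt0 : forall t x, V t -> V x -> 0 < p t x.

Local Notation P := (kop mu p).
Local Notation P' := (kop mu (fun x t => p t x)).
Local Notation mfun f := (measurable_fun [set: X] f).

Lemma kop_improving g x : intg mu g -> {ae mu, forall t, 0 <= g t} ->
  ~ {ae mu, forall t, g t = 0} -> V x -> 0 < P g x.
Proof.
move=> gi g0 gn0 Vx; apply: (kop_gt0 mp p01) => //.
by apply: filterS aeV => t Vt; exact: p_gt0.
Qed.

Lemma eigenfunction_gt0 (rho : R) g : 0 < rho -> intg mu g ->
  {ae mu, forall t, 0 <= g t} -> ~ {ae mu, forall t, g t = 0} ->
  {ae mu, forall x, P g x = rho * g x} -> {ae mu, forall x, 0 < g x}.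
Proof.
move=> r0 gi g0 gn0 Pg; apply: filterS2 Pg aeV => x Pgx Vx.
by rewrite -(pmulr_rgt0 _ r0) -Pgx; exact: kop_improving.
Qed.

Variables (rho : R) (phi psi : X -> R) (C : R).
Hypotheses (rho_gt0 : 0 < rho) (phi_int : intg mu phi).
Hypothesis phi_gt0 : {ae mu, forall x, 0 < phi x}.
Hypothesis Pphi : {ae mu, forall x, P phi x = rho * phi x}.
Hypotheses (mpsi : mfun psi) (psi_bd : forall x, `|psi x| <= C).
Hypothesis psi_gt0 : {ae mu, forall x, 0 < psi x}.
Hypothesis Ppsi : {ae mu, forall x, P' psi x = rho * psi x}.

Local Notation pair f := (\int[mu]_x (f x * psi x)).

Let psi_int : intg mu psi. Proof. exact: bounded_intg psi_bd. Qed.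

Let pair_intg f : intg mu f -> intg mu (fun x => f x * psi x).
Proof.
move=> fi; have := intgM_bounded mpsi psi_bd fi.
by rewrite (_ : (fun x => psi x * f x) = (fun x => f x * psi x))//;
  apply/funext => x; rewrite mulrC.
Qed.

(** Moving P to the other side of the pairing replaces it by its adjoint, for which [psi] is an
    eigenfunction. *)
Lemma pair_kop f : intg mu f -> pair (P f) = rho * pair f.
Proof.
move=> fi; rewrite kop_adjoint// -RintegralZl//; last exact: pair_intg.
apply: Rintegral_ae_eq.
- have mpT : measurable_fun setT (fun z : X * X => p z.2 z.1).
    exact: (measurableT_comp mp (@measurable_swap _ _ X X)).
  have pT01 (x t : X) : 0 <= p t x <= 1 by [].
  have bd x : `|P' psi x| <= \int[mu]_t `|psi t| by exact: kop_le_norm.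
  have := intgM_bounded (measurable_kop mpT pT01 psi_int) bd fi.
  by rewrite (_ : (fun x => P' psi x * f x) = (fun x => f x * P' psi x))//;
    apply/funext => x; rewrite mulrC.
- apply: measurable_funM => //; exact/intg_measurable/pair_intg.
- by apply: filterS Ppsi => x ->; rewrite mulrCA.
Qed.

Lemma pair_gt0 f : intg mu f -> {ae mu, forall x, 0 <= f x} ->
  ~ {ae mu, forall x, f x = 0} -> 0 < pair f.
Proof.
move=> fi f0 fn0; apply: ae_Rintegral_gt0; first exact: pair_intg.
- by apply: filterS2 f0 psi_gt0 => x fx px; rewrite mulr_ge0// ltW.
- move=> H; apply: fn0; apply: filterS2 psi_gt0 H => x px /eqP.
  by rewrite mulf_eq0 (gt_eqF px) orbF => /eqP.
Qed.

(* Subharmonic functions are harmonic: pair [P f - rho f] with [psi]. *)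
Lemma subeigenfunction_eigen f : intg mu f ->
  {ae mu, forall x, rho * f x <= P f x} -> {ae mu, forall x, P f x = rho * f x}.
Proof.
move=> fi sub; have Pfi := intg_kop mp p01 fi.
have gi : intg mu (fun x => P f x - rho * f x) by exact: intgB (intgZ _ _).
have g0 : {ae mu, forall x, 0 <= P f x - rho * f x}.
  by apply: filterS sub => x; rewrite subr_ge0.
have E : pair (fun x => P f x - rho * f x) = 0.
  transitivity (pair (P f) - rho * pair f); last by rewrite pair_kop// subrr.
  rewrite -RintegralZl//; last exact: pair_intg.
  rewrite -RintegralB//; [|exact: pair_intg|exact: intgZ (pair_intg _)].
  by apply: eq_Rintegral => x _; rewrite mulrBl mulrA.
have : {ae mu, forall x, P f x - rho * f x = 0}.
  by apply: contrapT => /(pair_gt0 gi g0); rewrite E ltxx.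
by apply: filterS => x /eqP; rewrite subr_eq0 => /eqP.
Qed.

(** |h| is subharmonic, hence harmonic, so |h| + h = 2 h^+ is a nonnegative eigenfunction: it
    vanishes or is positive almost everywhere. In the second case h > 0, which contradicts the zero
    pairing. *)
Let pos_part_eigen h : intg mu h -> {ae mu, forall x, P h x = rho * h x} ->
  pair h = 0 -> {ae mu, forall x, h x <= 0}.
Proof.
move=> hi Ph pair0; have ni := intg_norm hi.
have Pn : {ae mu, forall x, P (fun t => `|h t|) x = rho * `|h x|}.
  apply: subeigenfunction_eigen => //; apply: filterS Ph => x Phx.
  rewrite -[rho in leLHS](gtr0_norm rho_gt0) -normrM -Phx.
  apply: le_trans (le_normr_Rintegral _ _) _ => //; first exact: intg_kernel.
  rewrite le_eqVlt; apply/orP; left; apply/eqP; apply: eq_Rintegral => t _.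
  by rewrite normrM ger0_norm//; case/andP: (p01 t x).
pose g x := `|h x| + h x.
have gi : intg mu g by exact: intgD.
have g0 : {ae mu, forall x, 0 <= g x}.
  by apply: aeW => x; rewrite /g -lerBlDr sub0r -normrN ler_norm.
have Pg : {ae mu, forall x, P g x = rho * g x}.
  apply: filterS2 Ph Pn => x Phx Pnx.
  by rewrite (kopD mp p01)// Phx Pnx mulrDr.
have [gz|gn0] := pselect {ae mu, forall x, g x = 0}.
  apply: filterS gz => x gx; by rewrite -(addr0_eq gx) oppr_le0.
have h_gt0 : {ae mu, forall x, 0 < h x}.
  apply: filterS (eigenfunction_gt0 rho_gt0 gi g0 gn0 Pg) => x.
  by rewrite /g ltNge => H; rewrite ltNge; apply: contra H => hx;
     rewrite ler0_norm// addNr.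
have : 0 < pair h.
  apply: pair_gt0 => //; last exact: not_ae_eq0_gt0.
  by apply: filterS h_gt0 => x /ltW.
by rewrite pair0 ltxx.
Qed.

Lemma pairB_scale g : intg mu g ->
  pair (fun x => g x - pair g / pair phi * phi x) = 0.
Proof.
move=> gi; have phi0 : 0 < pair phi.
  apply: pair_gt0 => //; last exact: not_ae_eq0_gt0.
  by apply: filterS phi_gt0 => x /ltW.
set c := _ / _.
transitivity (pair g - c * pair phi); last by rewrite /c divfK ?subrr// gt_eqF.
rewrite -RintegralZl//; last exact: pair_intg.
rewrite -RintegralB//; [|exact: pair_intg|exact: intgZ (pair_intg _)].
by apply: eq_Rintegral => x _; rewrite mulrBl mulrA.
Qed.

(** The multiple of [phi] with the same pairing as [g] is subtracted; [pos_part_eigen] applied to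
    the difference and to its opposite makes it vanish. *)
Lemma eigenspace_line g : intg mu g -> {ae mu, forall x, P g x = rho * g x} ->
  exists c : R, {ae mu, forall x, g x = c * phi x}.
Proof.
move=> gi Pg; pose c := pair g / pair phi; exists c.
pose h x := g x - c * phi x.
have hi : intg mu h by exact: intgB (intgZ _ _).
have Ph : {ae mu, forall x, P h x = rho * h x}.
  apply: filterS2 Pg Pphi => x Pgx Pphix.
  rewrite (kopB mp p01)//; last exact: intgZ.
  by rewrite (kopZ mp p01)// Pgx Pphix mulrBr mulrCA.
have h0 : {ae mu, forall x, h x <= 0} by apply: pos_part_eigen => //; exact: pairB_scale.
have nh0 : {ae mu, forall x, -1 * h x <= 0}.
  apply: pos_part_eigen; first exact: intgZ.
    by apply: filterS Ph => x Phx; rewrite (kopZ mp p01)// Phx mulrCA.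
  transitivity (-1 * pair h); last by rewrite pairB_scale// mulr0.
  rewrite -RintegralZl//; last exact: pair_intg.
  by apply: eq_Rintegral => x _; rewrite mulrA.
apply: filterS2 h0 nh0 => x; rewrite mulN1r oppr_le0 => h1 h2.
by apply/eqP; rewrite -subr_eq0 eq_le h1.
Qed.

(** * Complex eigenvalues of the kernel operator *)

Section ComplexEigenvalue.
Variables (a b : X -> R) (al be : R).
Hypotheses (ai : intg mu a) (bi : intg mu b).
(** The equation P f = (al + i be) f for f = a + i b, in real and imaginary parts. Below, [u] is |f|
    and [m] is the modulus of the eigenvalue. *)
Hypothesis Pa : {ae mu, forall x, P a x = al * a x - be * b x}.
Hypothesis Pb : {ae mu, forall x, P b x = be * a x + al * b x}.
Hypothesis ab0 : ~ {ae mu, forall x, a x = 0 /\ b x = 0}.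

Let u x := Num.sqrt (a x ^+ 2 + b x ^+ 2).

Let u_ge x : `|a x| <= u x /\ `|b x| <= u x.
Proof.
by rewrite -!sqrtr_sqr /u; split; rewrite ler_wsqrtr// ?lerDl ?lerDr sqr_ge0.
Qed.

Let u2 x : u x ^+ 2 = a x ^+ 2 + b x ^+ 2.
Proof. by rewrite sqr_sqrtr// addr_ge0// sqr_ge0. Qed.

Let mu_ : mfun u.
Proof.
have ma := intg_measurable ai; have mb := intg_measurable bi.
apply: (measurableT_comp (f := @Num.sqrt R)).
  by apply: continuous_measurable_fun; exact: sqrt_continuous.
by apply: measurable_funD; exact: measurable_funX.
Qed.

Let ui : intg mu u.
Proof.
apply: (le_intg mu_ _ (intgD (intg_norm ai) (intg_norm bi))) => x.
rewrite ger0_norm ?sqrtr_ge0// ger0_norm ?addr_ge0//.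
rewrite -(@ler_pXn2r _ 2)// ?nnegrE ?sqrtr_ge0 ?addr_ge0//.
by rewrite u2 sqrrD !real_normK ?num_real// -addrA lerD2l lerDr mulrn_wge0.
Qed.

Let un0 : ~ {ae mu, forall x, u x = 0}.
Proof.
move=> H; apply: ab0; apply: filterS H => x ux0; have [] := u_ge x.
by rewrite ux0 !normr_le0 => /eqP -> /eqP ->.
Qed.

Let m := Num.sqrt (al ^+ 2 + be ^+ 2).

(** Cauchy-Schwarz, with Lagrange's identity giving the defect (s a - c b)^2; the equality case
    reuses that identity. *)
Let dir c s t : c ^+ 2 + s ^+ 2 = 1 -> c * a t + s * b t <= u t.
Proof.
move=> cs; apply: le_trans (ler_norm _) _.
rewrite -(@ler_pXn2r _ 2)// ?nnegrE ?sqrtr_ge0// u2 real_normK ?num_real//.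
have H : 0 <= (s * a t - c * b t) ^+ 2 by exact: sqr_ge0.
rewrite -[leRHS]mul1r -cs -subr_ge0.
apply: le_trans H _; rewrite le_eqVlt; apply/orP; left; apply/eqP; ring.
Qed.

Let dirP c s x : c * P a x + s * P b x = P (fun t => c * a t + s * b t) x.
Proof. by rewrite (kopD mp p01) ?(kopZ mp p01)//; exact: intgZ. Qed.

(* [|P f| <= P |f|] pointwise, by testing against the phase of [P f x]. *)
Let norm_le x : Num.sqrt (P a x ^+ 2 + P b x ^+ 2) <= P u x.
Proof.
set n := Num.sqrt _.
have [n0|n0] := eqVneq n 0.
  by rewrite n0; apply: (@kop_ge0 _ _ _ mu p p01) => t; exact: sqrtr_ge0.
have n2 : n ^+ 2 = P a x ^+ 2 + P b x ^+ 2 by rewrite sqr_sqrtr// addr_ge0// sqr_ge0.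
have cs : (P a x / n) ^+ 2 + (P b x / n) ^+ 2 = 1.
  by rewrite !expr_div_n -mulrDl -n2 divff// expf_neq0.
have -> : n = P a x / n * P a x + P b x / n * P b x.
  rewrite mulrAC [X in _ + X]mulrAC -mulrDl -!expr2 -n2 expr2 mulfK//.
rewrite dirP; apply: (le_kop mp p01) => //.
- exact: intgD (intgZ _ ai) (intgZ _ bi).
- by move=> t; exact: dir.
Qed.

Let norm_eig : {ae mu, forall x, Num.sqrt (P a x ^+ 2 + P b x ^+ 2) = m * u x}.
Proof.
apply: filterS2 Pa Pb => x -> ->; rewrite /m /u -sqrtrM ?addr_ge0 ?sqr_ge0//.
by congr Num.sqrt; ring.
Qed.

(** Pairing m u = |P f| <= P u with [psi] gives m pair(u) <= rho pair(u), and pair(u) > 0. *)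
Lemma eigenvalue_norm_le : m <= rho.
Proof.
have u0 : {ae mu, forall x, 0 <= u x} by apply: aeW => x; exact: sqrtr_ge0.
have pu := pair_gt0 ui u0 un0.
rewrite -(ler_pM2r pu) -(pair_kop ui) -RintegralZl//; last exact: pair_intg.
have Pui := intg_kop mp p01 ui.
rewrite -subr_ge0 -RintegralB//; [|exact: pair_intg|exact: intgZ (pair_intg _)].
(* The integrand is nonnegative only almost everywhere; its absolute value is so everywhere. *)
rewrite (@Rintegral_ae_eq _ _ _ _ _
   (fun x => `|P u x * psi x - m * (u x * psi x)|)).
- by apply: Rintegral_ge0 => x _.
- exact: intgB (pair_intg _) (intgZ _ (pair_intg _)).
- apply/intg_measurable/intg_norm.
  exact: intgB (pair_intg _) (intgZ _ (pair_intg _)).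
apply: filterS2 norm_eig psi_gt0 => x nx px.
by rewrite ger0_norm// mulrA -mulrBl mulr_ge0 ?(ltW px)// subr_ge0 -nx.
Qed.

(** Equality makes [u] harmonic, so |P f| = P |f| at some generic point x. As p(., x) > 0, equality
    in the triangle inequality forces f = (c + i s) u with a constant phase, and P f = rho f
    follows. *)
Lemma eigenvalue_norm_eq : m = rho -> al = rho /\ be = 0.
Proof.
move=> mr.
have Pu : {ae mu, forall x, P u x = rho * u x}.
  apply: subeigenfunction_eigen => //; apply: filterS norm_eig => x.
  by rewrite mr => <-.
have u0 : {ae mu, forall x, 0 <= u x} by apply: aeW => x; exact: sqrtr_ge0.
have [x [[nx Pux] Vx]] : exists x, (Num.sqrt (P a x ^+ 2 + P b x ^+ 2) = m * u x
    /\ P u x = rho * u x) /\ V x.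
  by apply: ae_exists; exact: filterI (filterI norm_eig Pu) aeV.
set n := Num.sqrt _ in nx.
have nP : n = P u x by rewrite nx mr Pux.
have n0 : 0 < n by rewrite nP; exact: kop_improving.
have n2 : n ^+ 2 = P a x ^+ 2 + P b x ^+ 2 by rewrite sqr_sqrtr// addr_ge0// sqr_ge0.
pose c := P a x / n; pose s := P b x / n.
have cs : c ^+ 2 + s ^+ 2 = 1.
  by rewrite !expr_div_n -mulrDl -n2 divff// expf_neq0// gt_eqF.
have nE : n = c * P a x + s * P b x.
  by rewrite /c /s mulrAC [X in _ + X]mulrAC -mulrDl -!expr2 -n2 expr2 mulfK// gt_eqF.
have wi : intg mu (fun t => c * a t + s * b t) by exact: intgD (intgZ _ ai) (intgZ _ bi).
have uw : {ae mu, forall t, p t x * (u t - (c * a t + s * b t)) = 0}.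
  apply: ae_eq0_Rintegral.
  - by apply: intg_kernel => //; exact: intgB.
  - apply: aeW => t; rewrite mulr_ge0//; first by case/andP: (p01 t x).
    by rewrite subr_ge0 dir.
  - have -> : \int[mu]_t (p t x * (u t - (c * a t + s * b t))) =
        P u x - P (fun t => c * a t + s * b t) x by rewrite -(kopB mp p01).
    by rewrite -dirP -nE nP subrr.
have ab : {ae mu, forall t, a t = c * u t /\ b t = s * u t}.
  apply: filterS2 uw aeV => t /eqP; rewrite mulf_eq0 => + Vt.
  rewrite (gt_eqF (p_gt0 Vt Vx))/= subr_eq0 => /eqP ut.
  have : (s * a t - c * b t) ^+ 2 = 0.
    have -> : (s * a t - c * b t) ^+ 2 = (c ^+ 2 + s ^+ 2) * (a t ^+ 2 + b t ^+ 2)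
       - (c * a t + s * b t) ^+ 2 by ring.
    by rewrite -ut cs mul1r -u2 subrr.
  move=> /eqP; rewrite expf_eq0/= => /eqP st; rewrite ut; split.
    have -> : c * (c * a t + s * b t) = (c ^+ 2 + s ^+ 2) * a t - s * (s * a t - c * b t) by ring.
    by rewrite cs st; ring.
  have -> : s * (c * a t + s * b t) = (c ^+ 2 + s ^+ 2) * b t + c * (s * a t - c * b t) by ring.
  by rewrite cs st; ring.
have Pab y : P a y = c * P u y /\ P b y = s * P u y.
  rewrite -!(kopZ mp p01)//; split; apply: kop_ae_eq => //; try exact: intgZ.
    by apply: filterS ab => t [].
  by apply: filterS ab => t [].
(* The relation rho f = (al + i be) f is multiplied by the conjugate of f, so no division by the
   phase is needed. *)
have : {ae mu, forall y, (rho - al) * u y ^+ 2 = 0 /\ be * u y ^+ 2 = 0}.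
  apply: filterS2 (filterI Pa Pb) (filterI ab Pu) => y [Pay Pby] [[ay by_] Puy].
  have [] := Pab y; rewrite Pay Pby Puy ay by_ u2 => H1 H2.
  rewrite ay by_; split.
    have -> : (rho - al) * ((c * u y) ^+ 2 + (s * u y) ^+ 2) =
      c * u y * (c * (rho * u y)) + s * u y * (s * (rho * u y)) -
      al * ((c * u y) ^+ 2 + (s * u y) ^+ 2) by ring.
    by rewrite -H1 -H2; ring.
  have -> : be * ((c * u y) ^+ 2 + (s * u y) ^+ 2) =
    c * u y * (be * (c * u y) + al * (s * u y)) -
    s * u y * (al * (c * u y) - be * (s * u y)) by ring.
  by rewrite H1 H2; ring.
move=> H; have [rz|rz] := eqVneq (rho - al) 0; last first.
  exfalso; apply: un0; apply: filterS H => y [/eqP + _].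
  by rewrite mulf_eq0 (negPf rz)/= expf_eq0/= => /eqP.
have [bz|bz] := eqVneq be 0; last first.
  exfalso; apply: un0; apply: filterS H => y [_ /eqP].
  by rewrite mulf_eq0 (negPf bz)/= expf_eq0/= => /eqP.
by split => //; apply/esym/eqP; rewrite -subr_eq0 rz.
Qed.

End ComplexEigenvalue.

End Jentzsch.

(** * Walks and good sequences *)

Section NumericalSemigroup.

(** The least positive difference d of two elements divides every element, so d = 1; from
    consecutive a, a + 1 in A every k >= a^2 is a sum. *)
Lemma semigroup_cofinite (A : nat -> Prop) : A 0%N ->
  (forall a b, A a -> A b -> A (a + b)%N) ->
  (forall e, (forall k, A k -> (e %| k)%N) -> (e %| 1)%N) ->
  exists N, forall k, (N <= k)%N -> A k.
Proof.
move=> A0 AD Agcd.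
have AM a q : A a -> A (q * a)%N.
  by move=> Aa; elim: q => // q IH; rewrite mulSn; exact: AD.
pose D := [pred d : nat | (0 < d)%N && `[< exists a, A a /\ A (a + d)%N >]].
have exD : exists d, D d.
  (* Without positive differences A is {0}, and then 2 divides all of A. *)
  apply: contrapT => nD; suff /Agcd : forall k, A k -> (2 %| k)%N by [].
  move=> [//|k] Ak; exfalso; apply: nD; exists k.+1.
  by apply/andP; split => //; apply/asboolP; exists 0%N.
have [d /andP[d0 /asboolP[a [Aa Aad]]] dmin] := ex_minnP exD.
have d1 : d = 1%N.
  apply/eqP; rewrite -dvdn1; apply: Agcd => k Ak.
  rewrite /dvdn; apply: contraT; rewrite -lt0n => r0.
  have : D (k %% d)%N.
    (* With k = q d + e, both q (a + d) and q (a + d) + e = q a + k lie in A, so the remainder e is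
       a smaller difference. *)
    rewrite inE r0; apply/asboolP; exists (k %/ d * (a + d))%N; split; first exact: AM.
    rewrite mulnDr -addnA -divn_eq addnC; apply: AD => //; exact: AM.
  by move=> /dmin; rewrite leqNgt ltn_pmod.
rewrite {}d1 addn1 in Aad.
have [a0|a0] := posnP a.
  by exists 0%N => k _; rewrite -[k]muln1; apply: AM; rewrite a0 in Aad.
exists (a * a)%N => k ak.
(* This makes k = (q - e) a + e (a + 1) a valid decomposition, with q and e the quotient and
   remainder of k by a. *)
have rq : (k %% a <= k %/ a)%N.
  by apply: ltnW; rewrite (leq_trans (ltn_pmod k a0))// leq_divRL.
have -> : k = ((k %/ a - k %% a) * a + k %% a * a.+1)%N.
  by rewrite mulnS [(_ * a + _)%N]addnC -addnA -mulnDl subnKC// addnC -divn_eq.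
by apply: AD; exact: AM.
Qed.

End NumericalSemigroup.

Section Walks.
Context {V : Type} (E : V -> V -> Prop).

Lemma walk_cat k l x y z : walk E k x y -> walk E l y z -> walk E (k + l) x z.
Proof.
elim: k x => [x /= ->//|k IH x /= [t xt ty] yz].
by exists t => //; exact: IH.
Qed.

(** The walk goes from x to y through [v] and is padded there by a closed walk of any sufficiently
    large length. *)
Lemma ergodic_walk : ergodic E ->
  forall x y, exists N, forall k, (N <= k)%N -> walk E k x y.
Proof.
move=> [sc [v [_ per]]] x y.
have [N NP] : exists N, forall k, (N <= k)%N -> walk E k v v.
  apply: (@semigroup_cofinite (fun k => walk E k v v)) => //.
  by move=> a b; exact: walk_cat.
have [a xv] := sc x v; have [b vy] := sc v y.
exists (a + N + b)%N => k; rewrite leq_eqVlt => k_ge.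
have -> : k = (a + (k - a - b) + b)%N.
  by case/predU1P: k_ge => [<-|k_gt]; lia.
apply: walk_cat vy; apply: walk_cat xv _; apply: NP.
by case/predU1P: k_ge => [<-|k_gt]; lia.
Qed.

End Walks.

(** * Order isomorphisms between finite sequences, and small perturbations *)

Section OrderIsomorphism.
Context {R : realType}.
Implicit Types (ps : seq (R * R)) (w : seq R).

(** The pairs form a finite correspondence between two sequences. Comparing both (x, y) and (y, x)
    shows that equality is preserved too, so this is a partial order isomorphism. *)
Definition order_iso ps := forall x y, x \in ps -> y \in ps ->
  (x.1 < y.1) = (x.2 < y.2).

Lemma sub_order_iso ps qs : {subset qs <= ps} -> order_iso ps -> order_iso qs.
Proof. by move=> sub iso x y /sub xp /sub yp; exact: iso. Qed.

Lemma order_iso_uniq ps : order_iso ps -> uniq (unzip1 ps) = uniq (unzip2 ps).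
Proof.
have eqE x y qs : order_iso qs -> x \in qs -> y \in qs -> (x.1 == y.1) = (x.2 == y.2).
  by move=> iso xq yq; rewrite !eq_le !leNgt !(iso _ _ xq yq) !(iso _ _ yq xq).
elim: ps => // x ps IH iso /=; rewrite IH; last first.
  by apply: sub_order_iso iso => y yps; rewrite inE yps orbT.
congr (~~ _ && _); apply/mapP/mapP => -[y yps].
  move=> /eqP xy; exists y => //; apply/eqP; rewrite -(eqE _ _ _ iso)//.
    exact: mem_head.
  by rewrite inE yps orbT.
move=> /eqP xy; exists y => //; apply/eqP; rewrite (eqE _ _ _ iso)//.
  exact: mem_head.
by rewrite inE yps orbT.
Qed.

Let max_of w a : exists2 b, b \in a :: w & forall c, c \in a :: w -> c <= b.
Proof.
elim: w a => [|x w IH] a; first by exists a; rewrite ?mem_head// => c /[!inE] /eqP ->.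
have [b bw bP] := IH x; have [ab|ba] := leP a b.
  exists b; first by rewrite inE bw orbT.
  by move=> c; rewrite inE => /predU1P[->//|]; exact: bP.
exists a; first exact: mem_head.
by move=> c; rewrite inE => /predU1P[->//|/bP/le_trans]; apply; exact: ltW.
Qed.

Let min_of w a : exists2 b, b \in a :: w & forall c, c \in a :: w -> b <= c.
Proof.
have [b bw bP] := max_of (map -%R w) (- a).
have {}bP c : c \in a :: w -> - c <= b.
  by move=> cw; apply: bP; rewrite -map_cons map_f.
move: bw; rewrite -map_cons => /mapP[b' bw bb'].
by exists b' => // c /bP; rewrite bb' lerN2.
Qed.

(** The one-point extension step of a back-and-forth argument in a dense order. *)
Lemma order_iso_extend ps t : order_iso ps ->
  (forall x, x \in ps -> 0 < x.2 < 1) -> 0 < t < 1 ->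
  exists2 t', 0 < t' < 1 & order_iso ((t, t') :: ps).
Proof.
move=> iso ps01 t01.
have [/mapP[x xps tx]|tps] := boolP (t \in unzip1 ps).
  exists x.2; first exact: ps01.
  apply: sub_order_iso iso => y; rewrite inE => /predU1P[->|//].
  by rewrite tx -surjective_pairing.
(* The new value is the midpoint between the images of the neighbours of [t]; the defaults 0 and 1
   keep it in the open unit interval. *)
have [a a_in aP] := max_of [seq x.2 | x <- ps & x.1 < t] 0.
have [b b_in bP] := min_of [seq x.2 | x <- ps & t < x.1] 1.
have aE x : x \in ps -> x.1 < t -> x.2 <= a.
  by move=> xps xt; apply: aP; rewrite inE map_f ?orbT// mem_filter xt.
have bE x : x \in ps -> t < x.1 -> b <= x.2.
  by move=> xps xt; apply: bP; rewrite inE map_f ?orbT// mem_filter xt.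
have a0 : 0 <= a by apply: aP; exact: mem_head.
have b1 : b <= 1 by apply: bP; exact: mem_head.
have ab : a < b.
  move: a_in b_in; rewrite !inE => /predU1P[->|/mapP[x + ->]] /predU1P[->|/mapP[y + ->]].
  - exact: ltr01.
  - by rewrite mem_filter => /andP[_ /ps01/andP[]].
  - by rewrite mem_filter => /andP[_ /ps01/andP[]].
  - rewrite !mem_filter => /andP[xt xps] /andP[ty yps].
    by rewrite -iso//; exact: lt_trans xt ty.
exists ((a + b) / 2); first by apply/andP; split; lra.
have cmp x : x \in ps -> (x.1 < t) = (x.2 < (a + b) / 2) /\ (t < x.1) = ((a + b) / 2 < x.2).
  move=> xps; have : t != x.1.
    by apply: contraNneq tps => ->; exact: map_f.
  rewrite neq_lt => /orP[tx|xt].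
    have := bE _ xps tx => bx; rewrite tx [x.1 < t]ltNge (ltW tx)/=; split.
      by apply/esym/negbTE; rewrite -leNgt; lra.
    by apply/esym; lra.
  have := aE _ xps xt => xa; rewrite xt [t < x.1]ltNge (ltW xt)/=; split.
    by apply/esym; lra.
  by apply/esym/negbTE; rewrite -leNgt; lra.
move=> x y; rewrite !inE => /predU1P[->|xps] /predU1P[->|yps] /=.
- by rewrite !ltxx.
- by case: (cmp _ yps).
- by case: (cmp _ xps).
- exact: iso.
Qed.

Lemma order_iso_extend_seq ps w : order_iso ps ->
  (forall x, x \in ps -> 0 < x.2 < 1) -> {in w, forall t, 0 < t < 1} ->
  exists qs, [/\ unzip1 qs = w, {in unzip2 qs, forall t, 0 < t < 1} &
    order_iso (qs ++ ps)].
Proof.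
move=> iso ps01; elim: w => [|t w IH] w01; first by exists [::].
have [|qs [qw qs01 isoq]] := IH.
  by move=> s sw; apply: w01; rewrite inE sw orbT.
have [||t' t'01 isot] := order_iso_extend (t := t) isoq.
- move=> x; rewrite mem_cat => /orP[xq|]; last exact: ps01.
  by apply: qs01; exact: map_f.
- by apply: w01; exact: mem_head.
exists ((t, t') :: qs); split => //=; first by rewrite qw.
by move=> s; rewrite inE => /predU1P[->//|]; exact: qs01.
Qed.

(** Beyond the common length the default 0 is compared with itself, which is harmless when e > 0. *)
Definition close (e : R) w w' :=
  size w' = size w /\ forall i, `|nth 0 w i - nth 0 w' i| < e.

Lemma close_take e w w' k : 0 < e -> close e w w' -> close e (take k w) (take k w').
Proof.
move=> e0 [sz ww']; split; first by rewrite !size_take sz.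
move=> i; have [ik|ki] := ltnP i k; first by rewrite !nth_take.
by rewrite !nth_default ?subrr ?normr0// size_take_min (leq_trans (geq_minl _ _)).
Qed.

Lemma close_behead e w w' : close e w w' -> close e (behead w) (behead w').
Proof.
move=> [sz ww']; split; first by rewrite !size_behead sz.
by move=> i; rewrite !nth_behead.
Qed.

Lemma close_le e e' w w' : e <= e' -> close e w w' -> close e' w w'.
Proof. by move=> ee' [sz ww']; split => // i; exact: lt_le_trans ee'. Qed.

(** The radius is half the smallest gap between entries, capped at 1, so no comparison can flip. *)
Lemma uniq_close_order_iso w : uniq w ->
  exists2 e : R, 0 < e & forall w', close e w w' -> order_iso (zip w w').
Proof.
move=> uw; pose gaps := [seq `|x.1 - x.2| / 2 | x <- [seq (a, b) | a <- w, b <- w] & x.1 != x.2].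
have [e e_in eP] := min_of gaps 1.
have e0 : 0 < e.
  move: e_in; rewrite inE => /predU1P[->//|/mapP[x]]; rewrite mem_filter => /andP[x12 _] ->.
  by rewrite divr_gt0// normr_gt0 subr_eq0.
exists e => // w' [sz ww'] x y.
have gap i j : (i < size w)%N -> (j < size w)%N -> i != j ->
    e <= `|nth 0 w i - nth 0 w j| / 2.
  move=> iw jw ij; apply: eP; rewrite inE; apply/orP; right.
  apply/mapP; exists (nth 0 w i, nth 0 w j) => //.
  rewrite mem_filter /= nth_uniq// ij; apply/allpairsP.
  by exists (nth 0 w i, nth 0 w j); rewrite !mem_nth.
pose z0 : R * R := (0, 0).
move=> xin yin; have [i + <-] := elimT (nthP z0) xin; rewrite size_zip sz minnn => iw.
have [j + <-] := elimT (nthP z0) yin; rewrite size_zip sz minnn => jw.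
rewrite /z0 !nth_zip//=; have [->|ij] := eqVneq i j; first by rewrite !ltxx.
have := gap i j iw jw ij; have := ww' i; have := ww' j.
move: (nth 0 w i) (nth 0 w j) (nth 0 w' i) (nth 0 w' j) => a b a' b'.
rewrite !ltr_norml => /andP[? ?] /andP[? ?].
have [ab|ab|->] := ltgtP a b.
- rewrite ltr0_norm ?subr_lt0// => ?; apply/esym; lra.
- rewrite gtr0_norm ?subr_gt0// => ?; apply/esym/negbTE; rewrite -leNgt; lra.
- by rewrite subrr normr0 => ?; lra.
Qed.

End OrderIsomorphism.

(** * Good sequences and their relation to walks *)

Section GoodSequences.
Context {R : realType} {m : nat} (S : {set 'S_m.+1}).
Implicit Types w : seq R.

(** [chi] as a predicate on sequences of any length, false unless the length is m+1; sequences can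
    then be cut and concatenated without casts. *)
Definition admissible w : bool :=
  uniq w && (if insub w is Some w' then pattern (w' : m.+1.-tuple R) \notin S
             else false).

Lemma chi_admissible (w : m.+1.-tuple R) : chi S w = (admissible w)%:R.
Proof.
by rewrite /chi /admissible valK; case: (uniq w) => //=; case: (_ \in S).
Qed.

(** This tests the first k windows; for a sequence of length k + m these are all of them. *)
Fixpoint good k w : bool :=
  if k is k'.+1 then admissible (take m.+1 w) && good k' (behead w) else true.

Lemma order_iso_admissible ps : order_iso ps ->
  admissible (unzip1 ps) = admissible (unzip2 ps).
Proof.
move=> iso; rewrite /admissible order_iso_uniq//; congr (_ && _).
case: insubP => [w|]; last first.
  by case: insubP => // w; rewrite !size_map => ->.
rewrite size_map => sz w1; case: insubP => [w'|]; last by rewrite size_map sz.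
rewrite size_map => _ w2.
have [x0 _] : {x0 : R * R | true} by exists (0, 0).
suff -> : pattern w = pattern w' by [].
rewrite /pattern; congr (odflt _ _); apply: eq_pick => s.
rewrite /has_pattern; apply: eq_forallb => i; apply: eq_forallb => j.
congr (_ == _); rewrite !(tnth_nth 0) w1 w2.
by rewrite !(nth_map x0) ?(eqP sz)//; apply: iso; rewrite mem_nth ?(eqP sz).
Qed.

Lemma order_iso_good k ps : order_iso ps ->
  good k (unzip1 ps) = good k (unzip2 ps).
Proof.
elim: k ps => //= k IH ps iso; rewrite /unzip1 /unzip2 -!map_take.
rewrite order_iso_admissible; last by apply: sub_order_iso iso => x /mem_take.
congr (_ && _); rewrite -!drop1 -!map_drop; apply: IH.
by apply: sub_order_iso iso => x /mem_drop.
Qed.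

Lemma close_admissible w : admissible w ->
  exists2 e : R, 0 < e & forall w', close e w w' -> admissible w'.
Proof.
move=> aw; have /andP[uw _] := aw; have [e e0 eP] := uniq_close_order_iso uw.
exists e => // w' ww'; have /order_iso_admissible := eP _ ww'.
by case: ww' => sz _; rewrite unzip1_zip ?sz// unzip2_zip ?sz// => <-.
Qed.

Lemma close_good k w : good k w ->
  exists2 e : R, 0 < e & forall w', close e w w' -> good k w'.
Proof.
elim: k w => [w _|k IH w /= /andP[/close_admissible[e1 e10 e1P] /IH[e2 e20 e2P]]].
  by exists 1.
exists (Num.min e1 e2); first by rewrite lt_min e10.
move=> w' ww'; apply/andP; split.
  apply: e1P; apply: close_le (close_take _ _ ww'); first by rewrite ge_min lexx.
  by rewrite lt_min e10.
apply: e2P; apply: close_le (close_behead ww'); first by rewrite ge_min lexx orbT.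
Qed.

(** Unlike [close_good], this also preserves failure of goodness, at the price of distinctness of
    the whole sequence rather than of each window. *)
Lemma uniq_close_good k w : uniq w ->
  exists2 e : R, 0 < e & forall w', close e w w' -> good k w' = good k w.
Proof.
move=> uw; have [e e0 eP] := uniq_close_order_iso uw.
exists e => // w' ww'; have /(order_iso_good k) := eP _ ww'.
by case: ww' => sz _; rewrite unzip1_zip ?sz// unzip2_zip ?sz// => <-.
Qed.

Lemma vertexP (x : @H_vertex R m) :
  [/\ size (sval x) = m, uniq (sval x) & {in sval x, forall t, 0 < t < 1}].
Proof.
by case: x => x /= /andP[/allP x01 ux]; rewrite size_tuple.
Qed.

Hypothesis m_gt0 : (0 < m)%N.

Lemma walk_good k (x y : H_vertex) : walk (H_edge S) k x y ->
  exists w, [/\ size w = (k + m)%N, take m w = sval x :> seq R,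
    drop k w = sval y :> seq R, {in w, forall t, 0 < t < 1} & good k w].
Proof.
elim: k x => [x /= <-|k IH x /= [z [w [xw zw w0m wS]] /IH[v [sv zv yv v01 gv]]]].
  have [sx _ x01] := vertexP x.
  by exists (sval x); split; rewrite ?drop0// -{1}sx take_size.
exists (thead w :: v).
have [sx ux x01] := vertexP x; have [sz uz z01] := vertexP z.
have wE : take m.+1 (thead w :: v) = w :> seq R.
  by rewrite /= zv zw [in RHS](tuple_eta w).
have w0 : thead w = nth 0 (sval x) 0 by rewrite xw nth_take// /thead (tnth_nth 0).
split => //=.
- by rewrite sv.
- by rewrite -(@take_takel _ _ m.+1)// wE -xw.
- move=> t; rewrite inE => /predU1P[->|]; last exact: v01.
  by rewrite w0; apply: x01; rewrite mem_nth// sx.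
rewrite gv andbT -/(take m.+1 (thead w :: v)) wE /admissible valK wS andbT.
have -> : tval w = thead w :: behead w by rewrite [in LHS](tuple_eta w).
rewrite /= -zw uz andbT.
(* The first entry of the window differs from the next m - 1 because they share the vertex [x], and
   from the last one by the edge condition. *)
apply/negP => tz; have [i + wi] := elimT (nthP 0) tz; rewrite sz => im; move: wi; rewrite zw nth_behead => wi.
have [im1|im1] := ltnP i.+1 m.
  have : nth 0 (sval x) i.+1 == nth 0 (sval x) 0 by rewrite {1}xw nth_take// wi w0.
  by rewrite nth_uniq// sx.
have {im1} im1 : i.+1 = m by apply/eqP; rewrite eqn_leq im im1.
by move/eqP: w0m; apply; rewrite !(tnth_nth 0) /=; move: wi; rewrite im1 /thead (tnth_nth 0).
Qed.

(* A walk between two vertices is transported to any pair of vertices in the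
   same relative position, and there are finitely many relative positions. *)
Lemma uniform_good : ergodic (@H_edge R m S) ->
  exists j, forall x y : @H_vertex R m, exists z,
    [/\ size z = j, {in z, forall t, 0 < t < 1} &
      good (m + j) (sval x ++ z ++ sval y)].
Proof.
move=> erg; pose I := ('I_(m + m) * 'I_(m + m))%type.
pose c (x y : @H_vertex R m) : {ffun I -> bool} := [ffun ij : I =>
  nth 0 (sval x ++ sval y) ij.1 < nth 0 (sval x ++ sval y) ij.2].
pose Q (x y : @H_vertex R m) k := exists z, [/\ size z = (k - m)%N, {in z, forall t, 0 < t < 1} &
      good k (sval x ++ z ++ sval y)].
have /choice[N NP] : forall c0, exists N, forall x y, c x y = c0 ->
    forall k, (N <= k)%N -> Q x y k.
  move=> c0; have [[x [y cxy]]|nc] := pselect (exists x y, c x y = c0); last first.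
    by exists 0%N => x y cxy; exfalso; apply: nc; exists x, y.
  have [N NP] := ergodic_walk erg x y; exists (N + m)%N => x' y' cxy' k Nk.
  have [|w [sw wx wy w01 gw]] := @walk_good k x y; first by apply: NP; lia.
  have [sx ux x01] := vertexP x; have [sy uy y01] := vertexP y.
  have [sx' ux' x01'] := vertexP x'; have [sy' uy' y01'] := vertexP y'.
  pose z := drop m (take k w).
  have wE : w = sval x ++ z ++ sval y.
    rewrite -wx -wy /z catA -{1}(@take_takel _ m k); last by lia.
    by rewrite !cat_take_drop.
  have sz : size z = (k - m)%N by rewrite /z size_drop size_takel// sw leq_addr.
  pose ps := zip (sval x ++ sval y) (sval x' ++ sval y').
  have sE : size (sval x ++ sval y) = size (sval x' ++ sval y').
    by rewrite !size_cat sx sx' sy sy'.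
  have iso : order_iso ps.
    pose z0 : R * R := (0, 0).
    move=> p q pin qin; have [i + <-] := elimT (nthP z0) pin.
    have [l + <-] := elimT (nthP z0) qin.
    rewrite /ps size_zip -sE minnn size_cat sx sy => lm im.
    rewrite /z0 !nth_zip//=.
    have := congr1 (fun f : {ffun I -> bool} => f (Ordinal im, Ordinal lm)) (etrans cxy (esym cxy')).
    by rewrite !ffunE.
  (* The interior of the walk is transported along the order isomorphism between the two pairs of
     end vertices. *)
  have [||qs [qz qs01 isoq]] := @order_iso_extend_seq _ ps z iso.
  - move=> p /(map_f snd); rewrite -/(unzip2 ps) unzip2_zip ?sE// mem_cat.
    by move=> /orP[/x01'|/y01'].
  - by move=> t tz; apply: w01; rewrite wE !mem_cat tz orbT.
  exists (unzip2 qs); split => //; first by rewrite size_map -(size_map fst) -/(unzip1 qs) qz.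
  pose px := zip (sval x) (sval x'); pose py := zip (sval y) (sval y').
  have pxy : ps = px ++ py by rewrite /ps zip_cat// sx.
  have isow : order_iso (px ++ qs ++ py).
    apply: sub_order_iso isoq => p; rewrite pxy !mem_cat.
    by move=> /orP[->|/orP[->|->]]; rewrite ?orbT.
  have := order_iso_good k isow; rewrite /unzip1 /unzip2 !map_cat.
  rewrite -!/(unzip1 _) -!/(unzip2 _) qz.
  by rewrite !unzip1_zip ?unzip2_zip ?sx ?sx' ?sy ?sy'// -wE gw => <-.
(* The maximum runs over the finitely many comparison tables of a pair of vertices; the total length
   m + j exceeds each threshold. *)
exists (\max_c0 N c0)%N => x y.
have [|z [sz z01 gz]] := NP (c x y) x y erefl (m + \max_c0 N c0)%N.
  by apply: leq_trans (leq_addl _ _); exact: leq_bigmax.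
by exists z; split => //; rewrite sz addKn.
Qed.

End GoodSequences.

(** * Integration over cubes *)

Section SequenceMeasurability.
Context {R : realType}.

(* Measurability of functions on finite sequences is measurability on
   [n]-tuples for every [n]; maps into sequences are required to have constant
   length. *)
Definition mfun_seq (F : seq R -> \bar R) :=
  forall n, measurable_fun setT (fun x : n.-tuple R => F x).

Definition mseq d (Y : measurableType d) (g : Y -> seq R) :=
  exists2 n, (forall y, size (g y) = n) &
    forall i, measurable_fun setT (fun y => nth 0 (g y) i).

Lemma mfun_seq_comp d (Y : measurableType d) (g : Y -> seq R) F :
  mfun_seq F -> mseq g -> measurable_fun setT (fun y => F (g y)).
Proof.
move=> mF [n sz mg]; pose G y : n.-tuple R := Tuple (introT eqP (sz y)).
have mG : measurable_fun setT G.
  apply/measurable_fun_tnthP => i.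
  by rewrite (_ : _ \o _ = fun y => nth 0 (g y) i)//; apply/funext => y /=; rewrite (tnth_nth 0).
exact: (measurableT_comp (mF n) mG).
Qed.

Lemma mseq_tuple n : mseq (fun x : n.-tuple R => tval x).
Proof.
exists n => [y|i]; first exact: size_tuple.
have [i_n|ni] := ltnP i n.
  rewrite (_ : (fun _ => _) = (fun x : n.-tuple R => tnth x (Ordinal i_n))).
    exact: measurable_tnth.
  by apply/funext => x; rewrite (tnth_nth 0).
rewrite (_ : (fun _ => _) = cst 0)//; apply/funext => x.
by rewrite nth_default// size_tuple.
Qed.

Lemma mseq_comp d (Y : measurableType d) d' (Z : measurableType d')
    (g : Y -> seq R) (h : Z -> Y) :
  mseq g -> measurable_fun setT h -> mseq (fun z => g (h z)).
Proof.
move=> [n sz mg] mh; exists n => // i.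
exact: (measurableT_comp (mg i) mh).
Qed.

Lemma mseq_cst d (Y : measurableType d) (s : seq R) : mseq (fun _ : Y => s).
Proof. by exists (size s). Qed.

Lemma mseq_cons d (Y : measurableType d) (f : Y -> R) (g : Y -> seq R) :
  measurable_fun setT f -> mseq g -> mseq (fun y => f y :: g y).
Proof.
move=> mf [n sz mg]; exists n.+1 => [y|[|i] //]; last exact: mg.
by rewrite /= sz.
Qed.

Lemma mseq_cat d (Y : measurableType d) (g h : Y -> seq R) :
  mseq g -> mseq h -> mseq (fun y => g y ++ h y).
Proof.
move=> [n sz mg] [k szh mh]; exists (n + k)%N => [y|i]; first by rewrite size_cat sz szh.
have [i_n|n_i] := ltnP i n.
  rewrite (_ : (fun _ => _) = (fun y => nth 0 (g y) i)); first exact: mg.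
  by apply/funext => y; rewrite nth_cat sz i_n.
rewrite (_ : (fun _ => _) = (fun y => nth 0 (h y) (i - n))); first exact: mh.
by apply/funext => y; rewrite nth_cat sz ltnNge n_i.
Qed.

Lemma mseq_take d (Y : measurableType d) (g : Y -> seq R) k :
  mseq g -> mseq (fun y => take k (g y)).
Proof.
move=> [n sz mg]; exists (minn k n) => [y|i]; first by rewrite size_take_min sz.
have [ik|ki] := ltnP i k.
  by under eq_fun do rewrite nth_take//; exact: mg.
rewrite (_ : (fun _ => _) = cst 0)//; apply/funext => y.
by rewrite nth_default// size_take_min (leq_trans (geq_minl _ _)).
Qed.

(* The order types of [n]-tuples form a finite measurable partition. *)
Lemma order_invariant_measurable (A : seq R -> bool) n :
  (forall ps, order_iso ps -> A (unzip1 ps) = A (unzip2 ps)) ->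
  measurable_fun setT (fun x : n.-tuple R => A x).
Proof.
move=> Ainv; pose I := ('I_n * 'I_n)%type.
pose c (x : n.-tuple R) : {ffun I -> bool} :=
  [ffun ij : I => tnth x ij.1 < tnth x ij.2].
have Ac (x y : n.-tuple R) : c x = c y -> A x = A y.
  move=> cxy; have sz : size x = size y by rewrite !size_tuple.
  have := Ainv (zip x y); rewrite unzip1_zip ?unzip2_zip ?sz//; apply.
  pose z0 : R * R := (0, 0).
  move=> p q pin qin; have [i + <-] := elimT (nthP z0) pin.
  have [j + <-] := elimT (nthP z0) qin.
  rewrite size_zip -sz minnn size_tuple => jn i_n.
  rewrite /z0 !nth_zip//=.
  have := congr1 (fun f : {ffun I -> bool} => f (Ordinal i_n, Ordinal jn)) cxy.
  by rewrite !ffunE /= !(tnth_nth 0).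
apply: (measurable_fun_bool true); rewrite setTI.
rewrite (_ : _ @^-1` _ = \bigcup_(d in [set d | exists2 x, c x = d & A x])
    \bigcap_(ij in [set: I]) [set x | (tnth x ij.1 < tnth x ij.2) = d ij]); last first.
  apply/seteqP; split => [x Ax|x [d [y <- Ay] H]] /=.
    by exists (c x); [exists x|move=> ij _ /=; rewrite ffunE].
  rewrite (Ac _ y)//; apply/ffunP => ij; rewrite [LHS]ffunE.
  exact: (H ij Logic.I).
apply: fin_bigcup_measurable => [|d _]; first exact: finite_finset.
apply: fin_bigcap_measurable => [|ij _]; first exact: finite_finset.
have := @measurable_fun_ltr _ _ R setT _ _ (@measurable_tnth _ R n ij.1) (@measurable_tnth _ R n ij.2).
move=> /(_ measurableT [set d ij]); rewrite setTI; apply.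
by [].
Qed.

Lemma mfun_seq_order_invariant (A : seq R -> bool) :
  (forall ps, order_iso ps -> A (unzip1 ps) = A (unzip2 ps)) ->
  mfun_seq (fun s => (A s)%:R%:E).
Proof.
move=> Ainv n; apply/measurable_EFinP.
have := @order_invariant_measurable A n Ainv.
by move=> /(measurableT_comp (f := fun b : bool => b%:R : R)); apply.
Qed.

End SequenceMeasurability.

(** * Tonelli formulas for the cube *)

Section CubeIntegral.
Context {R : realType}.
Implicit Types F G : seq R -> \bar R.
Local Notation U := (uniform_prob (@ltr01 R)).
Local Open Scope ereal_scope.

Definition cube_int n F := \int[cube_measure n]_x F (tval x).

Lemma eq_cube_int n F G : (forall s, size s = n -> F s = G s) ->
  cube_int n F = cube_int n G.
Proof. by move=> FG; apply: eq_integral => x _; rewrite FG// size_tuple. Qed.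

Lemma cube_int0 F : mfun_seq F -> cube_int 0 F = F [::].
Proof.
move=> mF; rewrite /cube_int /= integral_dirac//; last exact: (mF 0%N).
by rewrite diracT mul1e.
Qed.

Lemma cube_int_ge0 n F : (forall s, 0 <= F s) -> 0 <= cube_int n F.
Proof. by move=> F0; exact: integral_ge0. Qed.

Let measurable_cons_int F n : mfun_seq F -> measurable_fun setT
  (fun z : measurableTypeR R * n.-tuple R => F (z.1 :: tval z.2)).
Proof.
move=> mF; apply: (mfun_seq_comp mF); apply: mseq_cons => //.
by apply: (mseq_comp (h := snd)) => //; exact: mseq_tuple.
Qed.

Let cube_intE n F : mfun_seq F -> (forall s, 0 <= F s) ->
  cube_int n.+1 F = \int[(U \x cube_measure n)]_z F (z.1 :: tval z.2).
Proof.
move=> mF F0; rewrite /cube_int /=.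
by rewrite ge0_integral_distribution//; exact: (mF n.+1).
Qed.

Lemma cube_intS n F : mfun_seq F -> (forall s, 0 <= F s) ->
  cube_int n.+1 F = \int[U]_t cube_int n (fun s => F (t :: s)).
Proof.
move=> mF F0; rewrite cube_intE// fubini_tonelli1//.
exact: measurable_cons_int.
Qed.

Lemma cube_intSr n F : mfun_seq F -> (forall s, 0 <= F s) ->
  cube_int n.+1 F = cube_int n (fun s => \int[U]_t F (t :: s)).
Proof.
move=> mF F0; rewrite cube_intE// fubini_tonelli2//.
exact: measurable_cons_int.
Qed.

Lemma mfun_seq_cons F t : mfun_seq F -> mfun_seq (fun s => F (t :: s)).
Proof.
move=> mF n; apply: (mfun_seq_comp mF); apply: mseq_cons => //.
exact: mseq_tuple.
Qed.

Lemma mfun_seq_catr F s : mfun_seq F -> mfun_seq (fun s' => F (s' ++ s)).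
Proof.
move=> mF n; apply: (mfun_seq_comp mF); apply: mseq_cat; last exact: mseq_cst.
exact: mseq_tuple.
Qed.

Lemma mfun_seq_take F k : mfun_seq F -> mfun_seq (fun s => F (take k s)).
Proof.
move=> mF n; apply: (mfun_seq_comp mF); apply: mseq_take; exact: mseq_tuple.
Qed.

Lemma measurable_cube_int d (Y : measurableType d) k (F : Y -> seq R -> \bar R) :
  measurable_fun setT (fun z : Y * k.-tuple R => F z.1 (tval z.2)) ->
  (forall y s, 0 <= F y s) ->
  measurable_fun setT (fun y => cube_int k (F y)).
Proof.
move=> mF F0.
exact: (measurable_fun_fubini_tonelli_F (fun z : Y * k.-tuple R => F z.1 (tval z.2))).
Qed.

Lemma mfun_seq_cube_int F k : mfun_seq F -> (forall s, 0 <= F s) ->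
  mfun_seq (fun s => cube_int k (fun s' => F (s ++ s'))).
Proof.
move=> mF F0 n.
apply: (@measurable_cube_int _ _ k (fun x : n.-tuple R => fun s' => F (x ++ s'))) => //.
apply: (mfun_seq_comp mF); apply: mseq_cat.
  by apply: (mseq_comp (h := fst)) => //; exact: mseq_tuple.
by apply: (mseq_comp (h := snd)) => //; exact: mseq_tuple.
Qed.

Lemma mfun_seq_int F : mfun_seq F -> (forall s, 0 <= F s) ->
  mfun_seq (fun s => \int[U]_t F (t :: s)).
Proof.
move=> mF F0 n.
apply: (measurable_fun_fubini_tonelli_G
  (fun z : measurableTypeR R * n.-tuple R => F (z.1 :: tval z.2))) => //.
exact: measurable_cons_int.
Qed.

Lemma cube_int_cat n k F : mfun_seq F -> (forall s, 0 <= F s) ->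
  cube_int (n + k) F = cube_int n (fun s => cube_int k (fun s' => F (s ++ s'))).
Proof.
elim: n F => [|n IH] F mF F0.
  by rewrite cube_int0//; exact: (mfun_seq_cube_int k mF F0).
rewrite addSn cube_intS// [RHS]cube_intS//; last 2 first.
- exact: mfun_seq_cube_int.
- by move=> s; exact: cube_int_ge0.
apply: eq_integral => t _; rewrite IH//; exact: mfun_seq_cons.
Qed.

Lemma cube_int_cst n (c : \bar R) : 0 <= c -> cube_int n (fun _ => c) = c.
Proof.
move=> c0; rewrite /cube_int; transitivity (c * cube_measure n [set: _]).
  exact: integral_cst.
by rewrite probability_setT mule1.
Qed.

(** The last coordinate integrates out to 1. The measure is built by prepending coordinates, so
    reaching the last one takes [cube_int_cat]. *)
Lemma cube_int_take n F : mfun_seq F -> (forall s, 0 <= F s) ->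
  cube_int n.+1 (fun s => F (take n s)) = cube_int n F.
Proof.
move=> mF F0; rewrite -addn1 cube_int_cat//; last exact: mfun_seq_take.
apply: eq_cube_int => s sn; rewrite -[RHS](@cube_int_cst 1)//.
by apply: eq_cube_int => s' _; rewrite take_size_cat.
Qed.

(* The map [(t, x) |-> (t, x_1, ..., x_(n-1))] preserves measure. *)
Lemma cube_int_shift n F : mfun_seq F -> (forall s, 0 <= F s) ->
  cube_int n (fun s => \int[U]_t F (take n (t :: s))) = cube_int n F.
Proof.
move=> mF F0; rewrite -[RHS]cube_int_take//.
by rewrite -(@cube_intSr _ (fun s => F (take n s)))//; exact: mfun_seq_take.
Qed.

Lemma mfun_seq_uniq (s : seq R) :
  mfun_seq (fun y => (~~ uniq (y ++ s))%:R%:E).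
Proof.
apply: (@mfun_seq_catr (fun w => (~~ uniq w)%:R%:E) s).
by apply: (@mfun_seq_order_invariant _ (fun w => ~~ uniq w)) => ps /order_iso_uniq ->.
Qed.

(** Each newly prepended coordinate avoids the finitely many values already present with probability
    one. *)
Lemma ae_uniq_cat n (s : seq R) : uniq s ->
  {ae cube_measure n, forall y : n.-tuple R, uniq (y ++ s)}.
Proof.
move=> us; have z0 : cube_int n (fun y => (~~ uniq (y ++ s))%:R%:E) = 0.
  elim: n => [|n IH]; first by rewrite cube_int0 ?us//; exact: mfun_seq_uniq.
  rewrite cube_intSr//; last exact: mfun_seq_uniq.
  rewrite -[RHS]IH; apply: eq_cube_int => y _ /=.
  have [uys|nuys] := boolP (uniq (y ++ s)); last first.
    under eq_integral do rewrite andbF.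
    transitivity (1%:E * U [set: _]); first exact: integral_cst.
    by rewrite probability_setT mule1.
  have cA : countable [set` y ++ s] by apply: finite_set_countable; exact: finite_seq.
  have mA : measurable ([set` y ++ s] : set (measurableTypeR R)).
    by apply: countable_measurable.
  transitivity (\int[U]_t (\1_[set` y ++ s] t)%:E).
    by apply: eq_integral => t _; rewrite andbT negbK indicE; congr ((nat_of_bool _)%:R%:E);
      apply/idP/idP; rewrite inE.
  rewrite integral_indic// setIT.
  transitivity (lebesgue_measure ([set` y ++ s] `&` `[0%R, 1%R]) : \bar R).
    exact: uniform_probE.
  by apply: countable_lebesgue_measure0; exact: (sub_countable (subset_card_le (@subIsetl _ _ _))).
have mf : measurable_fun setT (fun x : n.-tuple R => (~~ uniq (tval x ++ s))%:R%:E : \bar R).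
  exact: (@mfun_seq_uniq s n).
have : \int[cube_measure n]_x `|(~~ uniq (tval x ++ s))%:R%:E| = 0 :> \bar R.
  by rewrite -[RHS]z0; apply: eq_integral => x _; rewrite gee0_abs// lee_fin.
move=> /(ae_eq_integral_abs _ measurableT mf); apply: filterS => x /= /(_ Logic.I).
by case: (uniq _) => //= -[] /eqP; rewrite oner_eq0.
Qed.

End CubeIntegral.

(** * The kernel of the iterated operator *)

Section TransferKernel.
Context {R : realType} {m : nat} (S : {set 'S_m.+1}).
Implicit Types F G : seq R -> \bar R.
Local Notation U := (uniform_prob (@ltr01 R)).
Local Notation good := (good S).
Local Open Scope ereal_scope.

(** The operator on nonnegative extended functions of sequences, where Tonelli applies without
    integrability. *)
Definition Te F (s : seq R) :=
  \int[U]_t ((admissible S (t :: s))%:R%:E * F (take m (t :: s))).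

Lemma mfun_seq_good k : mfun_seq (fun w : seq R => (good k w)%:R%:E).
Proof. by apply: mfun_seq_order_invariant => ps; exact: order_iso_good. Qed.

Let mfun_seq_weight (A : seq R -> bool) F :
  mfun_seq (fun w : seq R => (A w)%:R%:E) -> mfun_seq F ->
  mfun_seq (fun w => (A w)%:R%:E * F (take m w)).
Proof.
move=> mA mF n; apply: emeasurable_funM; first exact: mA.
exact: (mfun_seq_take m mF).
Qed.

Let weight_ge0 (A : seq R -> bool) F : (forall s, 0 <= F s) ->
  forall w, 0 <= (A w)%:R%:E * F (take m w).
Proof. by move=> F0 w; rewrite mule_ge0// lee_fin. Qed.

Lemma mfun_seq_Te F : mfun_seq F -> (forall s, 0 <= F s) -> mfun_seq (Te F).
Proof.
move=> mF F0; apply: (@mfun_seq_int _ (fun w => (admissible S w)%:R%:E * F (take m w))).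
  apply: mfun_seq_weight => //; apply: mfun_seq_order_invariant => ps.
  exact: order_iso_admissible.
exact: weight_ge0.
Qed.

Lemma Te_ge0 F s : (forall s, 0 <= F s) -> 0 <= Te F s.
Proof. by move=> F0; apply: integral_ge0 => t _; rewrite mule_ge0// lee_fin. Qed.

(** Each application prepends one variable and tests one new window; in the induction the newest
    variable is the innermost integral. *)
Lemma iter_Te k F s : mfun_seq F -> (forall s, 0 <= F s) -> size s = m ->
  iter k Te F s = cube_int k (fun y => (good k (y ++ s))%:R%:E * F (take m (y ++ s))).
Proof.
elim: k F => [|k IH] F mF F0 sm.
  rewrite cube_int0 /=; first by rewrite mul1e take_oversize// sm.
  apply: (@mfun_seq_catr _ (fun w => 1%:E * F (take m w))).
  by apply: (mfun_seq_weight (A := fun=> true)) => // n; exact: measurable_cst.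
rewrite iterSr IH//; [|exact: mfun_seq_Te|by move=> ?; exact: Te_ge0].
rewrite cube_intSr; last 2 first.
- apply: (@mfun_seq_catr _ (fun w => (good k.+1 w)%:R%:E * F (take m w))).
  exact: mfun_seq_weight (@mfun_seq_good k.+1) mF.
- by move=> y; exact: (weight_ge0 (good k.+1)).
apply: eq_cube_int => y _; rewrite /Te -ge0_integralZl//; last 2 first.
- have mY : mseq (fun t : measurableTypeR R => t :: take m (y ++ s)).
    by apply: mseq_cons => //; exact: mseq_cst.
  apply: (mfun_seq_comp (F := fun w => (admissible S w)%:R%:E * F (take m w))) mY.
  apply: mfun_seq_weight => //; apply: mfun_seq_order_invariant => ps.
  exact: order_iso_admissible.
- by move=> t _; rewrite mule_ge0// lee_fin.
apply: eq_integral => t _ /=.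
rewrite -(@take_takel _ m m.+1 (t :: (y ++ s)))// /=.
case: (admissible S _); rewrite ?mul0e ?mule0// mul1e.
by [].
Qed.

(** The weight is at most 1 and the shift preserves measure. This L^1 contraction is what keeps all
    iterates finite almost everywhere. *)
Lemma cube_int_Te_le F : mfun_seq F -> (forall s, 0 <= F s) ->
  cube_int m (Te F) <= cube_int m F.
Proof.
move=> mF F0; rewrite -(cube_int_shift m mF F0); apply: ge0_le_integral => //.
- by move=> x _; exact: Te_ge0.
- exact: mfun_seq_Te.
- by apply: (@mfun_seq_int _ (fun s => F (take m s))) => //; exact: mfun_seq_take.
move=> x _; apply: ge0_le_integral => //.
- by move=> t _; rewrite mule_ge0// lee_fin.
- apply: (mfun_seq_comp (F := fun w => (admissible S w)%:R%:E * F (take m w))).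
    apply: mfun_seq_weight => //; apply: mfun_seq_order_invariant => ps.
    exact: order_iso_admissible.
  by apply: mseq_cons => //; exact: mseq_cst.
- apply: (mfun_seq_comp (F := fun w => F (take m w))); first exact: mfun_seq_take.
  by apply: mseq_cons => //; exact: mseq_cst.
by move=> t _; case: (admissible S _); rewrite ?mul1e// mul0e.
Qed.

Variable j : nat.

Definition pe (t s : seq R) : \bar R :=
  cube_int j (fun z => (good (m + j) (t ++ z ++ s))%:R%:E).

Lemma pe_ge0 t s : 0 <= pe t s.
Proof. by apply: cube_int_ge0 => z; rewrite lee_fin. Qed.

Lemma mseq_catz t s n : mseq (fun z : n.-tuple R => t ++ tval z ++ s).
Proof.
by apply: mseq_cat; [exact: mseq_cst|apply: mseq_cat; [exact: mseq_tuple|exact: mseq_cst]].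
Qed.

Lemma pe_le1 t s : pe t s <= 1.
Proof.
rewrite -[leRHS](@cube_int_cst _ j)//; apply: ge0_le_integral => //.
  exact: (mfun_seq_comp (@mfun_seq_good _) (mseq_catz _ _ _)).
by move=> z _; rewrite lee_fin; case: (good _ _).
Qed.

Lemma pe_fin t s : pe t s \is a fin_num.
Proof. by rewrite ge0_fin_numE ?pe_ge0// (le_lt_trans (pe_le1 _ _))// ltry. Qed.

(** Of the m + j variables, the first m are the argument of F; integrating out the other j leaves
    the kernel. *)
Lemma iter_Te_kernel F s : mfun_seq F -> (forall s, 0 <= F s) -> size s = m ->
  iter (m + j) Te F s = cube_int m (fun t => pe t s * F t).
Proof.
move=> mF F0 sm; rewrite iter_Te//.
have mG : mfun_seq (fun w => (good (m + j) w)%:R%:E * F (take m w)).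
  exact: mfun_seq_weight (@mfun_seq_good _) mF.
rewrite cube_int_cat; last 2 first.
- exact: (@mfun_seq_catr _ (fun w => (good (m + j) w)%:R%:E * F (take m w))).
- by move=> y; exact: (weight_ge0 (good (m + j))).
apply: eq_cube_int => t tm.
rewrite /pe /cube_int muleC -ge0_integralZl//; last first.
  exact: (mfun_seq_comp (@mfun_seq_good _) (mseq_catz _ _ _)).
by apply: eq_integral => z _; rewrite muleC -catA take_size_cat.
Qed.

Definition kernel (t x : m.-tuple R) : R := fine (pe t x).

Lemma kernel01 t x : (0 <= kernel t x <= 1)%R.
Proof. by rewrite -!lee_fin fineK ?pe_fin// pe_ge0 pe_le1. Qed.

Lemma measurable_kernel :
  measurable_fun setT (fun z : m.-tuple R * m.-tuple R => kernel z.1 z.2).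
Proof.
apply: measurableT_comp => //.
apply: (@measurable_cube_int _ _ _ j (fun z : m.-tuple R * m.-tuple R =>
  fun y => (good (m + j) (tval z.1 ++ y ++ tval z.2))%:R%:E)).
  apply: (mfun_seq_comp (@mfun_seq_good _)).
  apply: mseq_cat.
    apply: (mseq_comp (h := fun z => z.1.1)); first exact: mseq_tuple.
    exact: measurableT_comp.
  apply: mseq_cat; first by apply: (mseq_comp (h := snd)) => //; exact: mseq_tuple.
  apply: (mseq_comp (h := fun z => z.1.2)); first exact: mseq_tuple.
  exact: measurableT_comp.
by move=> z y; rewrite lee_fin.
Qed.

End TransferKernel.

(** * Boxes in the cube and rational approximation *)

Section CubeBoxes.
Context {R : realType}.

Definition box n (s : seq R) (e : R) : set (n.-tuple R) := [set y | close e s y].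

Lemma boxE n (s : seq R) (e : R) : 0 < e -> size s = n ->
  @box n s e = [set y | forall i : 'I_n, [set t | `|nth 0 s i - t| < e] (tnth y i)].
Proof.
move=> e0 sn; apply/seteqP; split => [y [_ sy] i /=|y sy].
  by rewrite (tnth_nth 0); exact: sy.
split => [|i]; first by rewrite size_tuple sn.
have [i_n|ni] := ltnP i n; first by have := sy (Ordinal i_n); rewrite /= (tnth_nth 0).
by rewrite !nth_default ?subrr ?normr0 ?size_tuple ?sn.
Qed.

Let ballE (a e : R) : [set t | `|a - t| < e] = `]a - e, a + e[%classic.
Proof.
by apply/seteqP; split => t /=; rewrite in_itv/= ltr_norml => /andP[? ?];
  apply/andP; split; lra.
Qed.

Let measurable_ball01 (a e : R) : measurable ([set t | `|a - t| < e] : set R).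
Proof. by rewrite ballE; exact: measurable_itv. Qed.

Lemma measurable_box n (s : seq R) (e : R) : 0 < e -> size s = n -> measurable (@box n s e).
Proof.
move=> e0 sn; rewrite boxE// (_ : [set _ | _] =
  \bigcap_(i in [set: 'I_n]) ((fun x => tnth x i) @^-1` [set t | `|nth 0 s i - t| < e])).
  apply: fin_bigcap_measurable => // i _.
  by rewrite -[X in measurable X]setTI; apply: measurable_tnth.
by apply/seteqP; split => x h i; [move=> _; exact: h|exact: (h i Logic.I)].
Qed.

Lemma cube_measure_box_gt0 n (s : seq R) (e : R) : 0 < e -> size s = n ->
  {in s, forall t, 0 < t < 1} -> (0 < cube_measure n (@box n s e))%E.
Proof.
move=> e0 sn s01; rewrite boxE//.
have := @cube_measure_box R n (fun i : 'I_n => [set t | `|nth 0 s i - t| < e]).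
move=> ->; last by move=> i; exact: measurable_ball01.
apply: (big_ind (fun x : \bar R => 0 < x)%E) => [|x y|i _].
- exact: lte01.
- exact: mule_gt0.
have /andP[a0 a1] : 0 < nth 0 s i < 1 by apply: s01; rewrite mem_nth// sn.
set a := nth 0 s i in a0 a1 *.
(* The ball is clipped to the unit interval, which carries the measure; its centre is interior, so
   positive length remains. *)
pose l := Num.max 0 (a - e); pose r := Num.min 1 (a + e).
have lr : l < r.
  by rewrite /l /r gt_max !lt_min; apply/andP; split; apply/andP; split; lra.
have sub : `]l, r[%classic `<=` [set t | `|a - t| < e] `&` `[0, 1].
  move=> t /=; rewrite in_itv/= /l /r gt_max lt_min => /andP[/andP[t0 t1] /andP[t2 t3]].
  by split; [rewrite ltr_norml; apply/andP; split; lra|rewrite in_itv/=; apply/andP; split; lra].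
apply: (@lt_le_trans _ _ (lebesgue_measure `]l, r[%classic)).
  by rewrite lebesgue_measure_itv/= lte_fin lr EFinN -EFinD lte_fin subr_gt0.
apply: le_measure; rewrite ?inE//.
by apply: measurableI; [exact: measurable_ball01|exact: measurable_itv].
Qed.

Lemma ae_cube_interior n :
  {ae @cube_measure R n, forall x : n.-tuple R, all (fun t => 0 < t < 1) x}.
Proof.
pose A (i : 'I_n) : set R := `]0, 1[%classic.
have mu1 : cube_measure n [set x | forall i, A i (tnth x i)] = 1%E.
  have := @cube_measure_box R n A; move=> ->; last by move=> i; exact: measurable_itv.
  rewrite big1// => i _; rewrite (_ : _ `&` _ = `]0, 1[%classic).
    by rewrite lebesgue_measure_itv/= lte_fin ltr01 oppr0 adde0.
  by apply/setIidl => t /=; rewrite !in_itv/= => /andP[/ltW -> /ltW ->].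
have mA : measurable [set x : n.-tuple R | forall i, A i (tnth x i)].
  rewrite (_ : [set _ | _] =
    \bigcap_(i in [set: 'I_n]) ((fun x => tnth x i) @^-1` A i)).
    apply: fin_bigcap_measurable => // i _.
    by rewrite -[X in measurable X]setTI; apply: measurable_tnth => //; exact: measurable_itv.
  by apply/seteqP; split => x h i; [move=> _; exact: h|exact: (h i Logic.I)].
exists (~` [set x | forall i, A i (tnth x i)]); split.
- exact: measurableC.
- by rewrite probability_setC// mu1 subee.
- apply: subsetC => x H /=; apply/(all_nthP 0) => i; rewrite size_tuple => i_n.
  by have := H (Ordinal i_n); rewrite /A /= in_itv/= (tnth_nth 0).
Qed.

Lemma close_cat e (a a' b b' : seq R) : close e a a' -> close e b b' ->
  close e (a ++ b) (a' ++ b').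
Proof.
move=> [sa Ha] [sb Hb]; split; first by rewrite !size_cat sa sb.
by move=> i; rewrite !nth_cat sa; case: ifP.
Qed.

Lemma close_refl e (a : seq R) : 0 < e -> close e a a.
Proof. by move=> e0; split => // i; rewrite subrr normr0. Qed.

Lemma rational_approximation n (x : n.-tuple R) (e : R) : 0 < e ->
  exists q : n.-tuple rat, close e x (map ratr q).
Proof.
move=> e0; have /choice[q qP] : forall i : 'I_n, exists q : rat,
    `|tnth x i - ratr q| < e.
  move=> i; have [|q] := @rat_in_itvoo R (tnth x i - e) (tnth x i + e); first lra.
  rewrite in_itv/= => /andP[? ?]; exists q; rewrite ltr_norml; apply/andP; split; lra.
have [t tE] : exists t : n.-tuple rat, forall i, tnth t i = q i.
  by exists [tuple q i | i < n] => i; rewrite tnth_mktuple.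
have st : size (map ratr t : seq R) = n by rewrite size_map size_tuple.
exists t; split; first by rewrite st size_tuple.
move=> i; have [i_n|ni] := ltnP i n; last first.
  by rewrite !nth_default ?st ?size_tuple// subrr normr0.
have := qP (Ordinal i_n); rewrite -tE !(tnth_nth 0)/=.
by rewrite (nth_map 0) ?size_tuple.
Qed.

(** Since x enters only through A x, |P g x - P g x'| is at most the integral of |A x - A x'|,
    uniformly in g. Along rational points tending to x this tends to 0 by bounded convergence, A
    being locally constant in x for almost every y. *)
Lemma locally_constant_separable n k (A : n.-tuple R -> k.-tuple R -> bool)
    (V : set (n.-tuple R)) (P : (n.-tuple R -> R) -> n.-tuple R -> R) :
  (forall x, measurable_fun setT (fun y => (A x y)%:R : R)) ->
  (forall x, V x -> {ae cube_measure k, forall y,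
     exists2 e : R, 0 < e & forall x' : n.-tuple R, close e x x' -> A x' y = A x y}) ->
  (forall g : n.-tuple R -> R, measurable_fun setT g -> (forall t, 0 <= g t <= 1) ->
     exists G : k.-tuple R -> R, [/\ measurable_fun setT G, forall y, `|G y| <= 1 &
     forall x, P g x = \int[cube_measure k]_y ((A x y)%:R * G y)]) ->
  exists D : nat -> n.-tuple R, forall x, V x -> forall e : R, 0 < e -> exists j,
    forall g : n.-tuple R -> R, measurable_fun setT g -> (forall t, 0 <= g t <= 1) ->
    `|P g x - P g (D j)| <= e.
Proof.
move=> mA Aloc PE.
(* An enumeration of the rational points; codes that do not decode are sent to the origin. *)
pose D (i : nat) : n.-tuple R :=
  if unpickle i is Some q then map_tuple ratr (q : n.-tuple rat) else nseq_tuple n 0.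
exists D => x Vx e e0.
have /choice[q qP] : forall i, exists q : n.-tuple rat, close (i.+1%:R^-1) x (map ratr q).
  by move=> i; apply: rational_approximation; rewrite invr_gt0.
have Dq i : D (pickle (q i)) = map_tuple ratr (q i) by rewrite /D pickleK.
pose f i y : R := `|(A (map_tuple ratr (q i)) y)%:R - (A x y)%:R|.
have mf i : measurable_fun setT (f i).
  by apply: measurableT_comp => //; exact: measurable_funB.
have f1 i y : `|f i y| <= 1.
  rewrite normr_id /f; case: (A _ y); case: (A _ y);
  by rewrite ?subrr ?subr0 ?sub0r ?normrN ?normr0 ?normr1.
have fcvg : {ae cube_measure k, forall y, f i y @[i --> \oo] --> cst (0 : R) y}.
  apply: filterS (Aloc x Vx) => y [r r0 rP].
  apply/cvgrPdist_lt => eps eps0; near=> i.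
  rewrite sub0r normrN /f rP ?subrr ?normr0 ?normr0//.
  apply: close_le (qP i); apply/ltW; near: i.
  exact: (near_infty_natSinv_lt (PosNum r0)).
have := cvg_Rintegral_bounded mf (measurable_cst (0 : R)) f1 fcvg.
rewrite Rintegral_const => /cvgrPdist_le/(_ e e0)[i _ /(_ i (leqnn i))] /=.
rewrite sub0r normrN => fie.
exists (pickle (q i)) => g mg g01; rewrite Dq.
have [G [mG G1 GE]] := PE g mg g01; rewrite !GE.
have bi (B : k.-tuple R -> bool) : measurable_fun setT (fun y => (B y)%:R : R) ->
    intg (cube_measure k) (fun y => (B y)%:R * G y).
  move=> mB; apply: (@bounded_intg _ _ _ _ _ 1); first exact: measurable_funM.
  by move=> y; rewrite normrM; case: (B y); rewrite ?normr1 ?mul1r// normr0 mul0r.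
rewrite distrC -RintegralB//; try exact: bi.
apply: le_trans (le_normr_Rintegral _ _) _ => //; first exact: intgB (bi _ _) (bi _ _).
apply: le_trans (le_trans (ler_norm _) fie); apply: le_Rintegral => //.
- exact: intg_norm (intgB (bi _ _) (bi _ _)).
- by apply: (@bounded_intg _ _ _ _ _ 1); [exact: mf|exact: f1].
move=> y _; rewrite -mulrBl normrM -[leRHS]mulr1; apply: ler_wpM2l => //.
Unshelve. all: by end_near. Qed.

End CubeBoxes.

(** * Extending functions of tuples to sequences by zero *)

Section Extension.
Context {R : realType} {m : nat}.

Definition extend (g : m.-tuple R -> R) (s : seq R) : R :=
  if insub s is Some x then g x else 0.

Lemma extendE g (x : m.-tuple R) : extend g x = g x.
Proof. by rewrite /extend valK. Qed.

Lemma extend_ge0 g s : (forall x, 0 <= g x) -> (0 <= (extend g s)%:E)%E.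
Proof. by move=> g0; rewrite lee_fin /extend; case: insubP. Qed.

Lemma mfun_seq_extend g : measurable_fun setT g ->
  mfun_seq (fun s => (extend g s)%:E).
Proof.
move=> mg n; apply/measurable_EFinP; have [nm|nm] := eqVneq n m.
  by subst n; under eq_fun do rewrite extendE.
rewrite (_ : (fun _ => _) = cst 0)//; apply/funext => x.
rewrite /extend; case: insubP => // y; rewrite size_tuple => /eqP nm'.
by rewrite nm' eqxx in nm.
Qed.

Lemma mseq_drop d (Y : measurableType d) (g : Y -> seq R) k :
  mseq g -> mseq (fun y => drop k (g y)).
Proof.
move=> [n sz mg]; exists (n - k)%N => [y|i]; first by rewrite size_drop sz.
by under eq_fun do rewrite nth_drop; exact: mg.
Qed.

End Extension.

(** * Positivity and separability of the kernel *)

Section KernelProperties.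
Context {R : realType} {m : nat} (S : {set 'S_m.+1}) (j : nat).
Local Notation X := (m.-tuple R).
Local Notation mu := (@cube_measure R m).
Local Notation good := (good S).
Local Notation p := (@kernel R m S j).

Let p01 := @kernel01 R m S j.
Let mp := @measurable_kernel R m S j.

(** Every middle piece in the box around [z0] remains good, so its volume bounds the kernel from
    below. *)
Lemma kernel_lower (t0 x0 : X) (z0 : seq R) (e : R) : 0 < e -> size z0 = j ->
  (forall w, close e (t0 ++ z0 ++ x0) w -> good (m + j) w) ->
  forall t x : X, close e t0 t -> close e x0 x ->
  (cube_measure j (@box R j z0 e) <= (p t x)%:E)%E.
Proof.
move=> e0 sz0 goodw t x tt0 xx0; rewrite fineK ?pe_fin//.
have mB := measurable_box e0 sz0.
rewrite -[X in cube_measure j X]setIT -integral_indic//; apply: ge0_le_integral => //.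
- exact/measurable_EFinP/measurable_indic.
- exact: (mfun_seq_comp (@mfun_seq_good _ _ _ _) (mseq_catz _ _ _)).
move=> z _; rewrite lee_fin indicE; have [zB|//] := boolP (z \in _).
rewrite goodw//; apply: close_cat => //; apply: close_cat => //.
by move: zB; rewrite inE.
Qed.

Definition generic_cube := [set x : X | all (fun t => 0 < t < 1) x && uniq x].
Local Notation V := generic_cube.

Lemma ae_generic_cube : {ae mu, forall x, V x}.
Proof.
apply: filterS2 (@ae_cube_interior R m) (@ae_uniq_cat R m [::] isT) => x xI.
by rewrite cats0 /V /= xI.
Qed.

Hypothesis paths : forall x y : @H_vertex R m, exists z, [/\ size z = j,
  {in z, forall t, 0 < t < 1} & good (m + j) (sval x ++ z ++ sval y)].

Let box_bound (t x : X) : V t -> V x -> exists e d : R, [/\ 0 < e, 0 < d &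
  forall t' x' : X, close e t t' -> close e x x' -> d <= p t' x'].
Proof.
move=> Vt Vx; have [z [sz z01 gz]] := paths (exist _ t Vt) (exist _ x Vx).
have [e e0 eP] := close_good gz.
have := cube_measure_box_gt0 e0 sz z01.
have fB : (cube_measure j (@box R j z e) \is a fin_num)%E.
  by apply: fin_num_measure; exact: measurable_box.
rewrite -(fineK fB) lte_fin => B0.
exists e, (fine (cube_measure j (@box R j z e))); split => // t' x' tt' xx'.
by rewrite -lee_fin fineK//; exact: kernel_lower eP _ _ tt' xx'.
Qed.

Lemma kernel_gt0 t x : V t -> V x -> 0 < p t x.
Proof.
move=> Vt Vx; have [e [d [e0 d0 H]]] := box_bound Vt Vx.
by apply: lt_le_trans d0 (H _ _ _ _); exact: close_refl.
Qed.

(** [u] is the indicator of a box around the vertex. The kernel is at least d on the square of that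
    box, a bound symmetric in its arguments, so one [delta] serves P and its adjoint. *)
Lemma kernel_minorization (v : @H_vertex R m) :
  exists (u : X -> R) (delta : R),
   [/\ measurable_fun setT u, forall x, 0 <= u x <= 1, 0 < u (sval v), 0 < delta &
    (forall x, delta * u x <= kop mu p u x) /\
    (forall x, delta * u x <= kop mu (fun x t => p t x) u x)].
Proof.
case: v => x Vx /=; have [e [d [e0 d0 H]]] := box_bound Vx Vx.
have sx : size x = m by rewrite size_tuple.
have x01 : {in tval x, forall t, 0 < t < 1}.
  by move: Vx => /andP[/allP x01 _] t /x01.
have mB : measurable (@box R m x e) := measurable_box e0 sx.
have fB : (mu (@box R m x e) \is a fin_num)%E by apply: fin_num_measure.
have := cube_measure_box_gt0 e0 sx x01; rewrite -(fineK fB) lte_fin => B0.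
have mI : measurable_fun setT (\1_(@box R m x e) : X -> R) by exact: measurable_indic.
have I01 y : 0 <= (\1_(@box R m x e) y : R) <= 1.
  by rewrite indicE; case: (_ \in _); rewrite ?lexx ler01.
have II : intg mu (\1_(@box R m x e) : X -> R).
  by apply: (@bounded_intg _ _ _ _ _ 1) => // y; case/andP: (I01 y) => ? ?; rewrite ger0_norm.
have intI : \int[mu]_y (\1_(@box R m x e) y : R) = fine (mu (@box R m x e)).
  by rewrite /Rintegral integral_indic// setIT.
exists \1_(@box R m x e), (d * fine (mu (@box R m x e))); split => //.
- by rewrite indicE mem_set//; exact: close_refl.
- exact: mulr_gt0.
have low (q : X -> X -> R) : measurable_fun setT (fun z : X * X => q z.1 z.2) ->
    (forall t x, 0 <= q t x <= 1) ->
    (forall t' x' : X, close e x t' -> close e x x' -> d <= q t' x') ->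
    forall y, d * fine (mu (@box R m x e)) * \1_(@box R m x e) y <=
      kop mu q \1_(@box R m x e) y.
  move=> mq q01 qd y; rewrite indicE; have [yB|yB] := boolP (y \in _); last first.
    rewrite mulr0; apply: Rintegral_ge0 => t _; rewrite mulr_ge0//.
    by case/andP: (q01 t y).
  rewrite mulr1 -intI -RintegralZl//; apply: le_Rintegral => //.
  - exact: intgZ.
  - exact: intg_kernel.
  move=> t _; rewrite indicE; have [tB|tB] := boolP (t \in _); last by rewrite !mulr0.
  rewrite !mulr1; apply: qd; first by move: tB; rewrite inE.
  by move: yB; rewrite inE.
split; first exact: low.
apply: low => //; first exact: (measurableT_comp mp (@measurable_swap _ _ X X)).
by move=> t' x' ? ?; exact: H.
Qed.

Let bounded01 (g : X -> R) : (forall t, 0 <= g t <= 1) ->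
  forall s, `|extend g s| <= 1.
Proof.
move=> g01 s; rewrite /extend; case: insubP => [y _ _|_]; last by rewrite normr0.
by case/andP: (g01 y) => ? ?; rewrite ger0_norm.
Qed.

Let measurable_good_cat n (f : n.-tuple R -> seq R) : mseq f ->
  measurable_fun setT (fun y => (good (m + j) (f y))%:R : R).
Proof.
by move=> mf; apply/measurable_EFinP; exact: (mfun_seq_comp (@mfun_seq_good _ _ _ _) mf).
Qed.

(** P g x is written as an integral over all m + j variables: the indicator of goodness is locally
    constant in x, which the kernel, an integral of it, need not be. *)
Lemma kop_separable : exists D : nat -> X, forall x, V x ->
  forall e : R, 0 < e -> exists i, forall g : X -> R,
  measurable_fun setT g -> (forall t, 0 <= g t <= 1) ->
  `|kop mu p g x - kop mu p g (D i)| <= e.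
Proof.
apply: (@locally_constant_separable R m (m + j)
  (fun (x : X) (y : (m + j).-tuple R) => good (m + j) (y ++ x))).
- move=> x; apply: measurable_good_cat.
  by apply: mseq_cat; [exact: mseq_tuple|exact: mseq_cst].
- move=> x /andP[_ ux]; apply: filterS (ae_uniq_cat (m + j) ux) => y uyx.
  have [e e0 eP] := uniq_close_good S (m + j) uyx.
  by exists e => // x' xx'; apply: eP; apply: close_cat => //; exact: close_refl.
move=> g mg g01; exists (fun y => extend g (take m y)); split.
- apply/measurable_EFinP; apply: (mfun_seq_comp (mfun_seq_extend mg)).
  by apply: mseq_take; exact: mseq_tuple.
- by move=> y; exact: bounded01.
move=> x; have g0 y : 0 <= g y by case/andP: (g01 y).
have e0 s := extend_ge0 s g0; have mE := mfun_seq_extend mg.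
congr fine; have := iter_Te_kernel S j mE e0 (size_tuple x).
rewrite iter_Te ?size_tuple// => E; apply/esym.
transitivity (cube_int (m + j) (fun y =>
  ((good (m + j) (y ++ x))%:R%:E * (extend g (take m (y ++ x)))%:E)%E)).
  apply: eq_integral => y _; rewrite EFinM takel_cat// size_tuple.
  exact: leq_addr.
rewrite E; apply: eq_integral => t _.
by rewrite extendE EFinM fineK ?pe_fin.
Qed.

(** Here the free vertex comes first and g reads the last m variables, so Tonelli must exchange the
    two blocks. *)
Lemma kop_adjoint_separable : exists D : nat -> X, forall x, V x ->
  forall e : R, 0 < e -> exists i, forall g : X -> R,
  measurable_fun setT g -> (forall t, 0 <= g t <= 1) ->
  `|kop mu (fun x t => p t x) g x - kop mu (fun x t => p t x) g (D i)| <= e.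
Proof.
apply: (@locally_constant_separable R m (j + m)
  (fun (t : X) (y : (j + m).-tuple R) => good (m + j) (t ++ y))).
- move=> x; apply: measurable_good_cat.
  by apply: mseq_cat; [exact: mseq_cst|exact: mseq_tuple].
- move=> x /andP[_ ux]; apply: filterS (ae_uniq_cat (j + m) ux) => y.
  rewrite uniq_catC => uyx.
  have [e e0 eP] := uniq_close_good S (m + j) uyx.
  by exists e => // x' xx'; apply: eP; apply: close_cat => //; exact: close_refl.
move=> g mg g01; exists (fun y => extend g (drop j y)); split.
- apply/measurable_EFinP; apply: (mfun_seq_comp (mfun_seq_extend mg)).
  by apply: mseq_drop; exact: mseq_tuple.
- by move=> y; exact: bounded01.
move=> t; have g0 y : 0 <= g y by case/andP: (g01 y).
have e0 s := extend_ge0 s g0; have mE := mfun_seq_extend mg.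
pose G y := ((good (m + j) (t ++ y))%:R%:E * (extend g (drop j y))%:E : \bar R)%E.
have mG : mfun_seq G.
  move=> n; apply: emeasurable_funM.
    apply: (mfun_seq_comp (@mfun_seq_good _ _ _ _)).
    by apply: mseq_cat; [exact: mseq_cst|exact: mseq_tuple].
  by apply: (mfun_seq_comp mE); apply: mseq_drop; exact: mseq_tuple.
have G0 y : (0 <= G y)%E by rewrite mule_ge0// lee_fin.
congr fine; apply/esym; transitivity (cube_int (j + m) G).
  by apply: eq_integral => y _; rewrite EFinM.
rewrite cube_int_cat// /cube_int.
rewrite (fubini_tonelli (fun z : j.-tuple R * X => G (z.1 ++ z.2)))//; last first.
  apply: (mfun_seq_comp mG); apply: mseq_cat.
    by apply: (mseq_comp (h := fst)) => //; exact: mseq_tuple.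
  by apply: (mseq_comp (h := snd)) => //; exact: mseq_tuple.
apply: eq_integral => x _; rewrite EFinM fineK ?pe_fin// /pe /cube_int muleC.
rewrite -ge0_integralZl//; last 2 first.
- exact: (mfun_seq_comp (@mfun_seq_good _ _ _ _) (mseq_catz _ _ _)).
- by rewrite lee_fin.
apply: eq_integral => z _; rewrite /G /= muleC drop_size_cat ?size_tuple//.
by rewrite extendE.
Qed.

End KernelProperties.

(** * The transfer operator on integrable functions *)

Section TransferOperator.
Context {R : realType} {m : nat} (S : {set 'S_m.+1}).
Local Notation X := (m.-tuple R).
Local Notation mu := (@cube_measure R m).
Local Notation U := (uniform_prob (@ltr01 R)).
Implicit Types g h : X -> R.

#[local] Instance ae_uniform_filter : Filter (nbhs (almost_everywhere U)).
Proof. exact: ae_filter_ringOfSetsType. Qed.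

Definition slice g (x : X) (t : R) : R :=
  chi S [tuple of t :: x] * g [tuple of belast t x].

Definition T_real g (x : X) : R := \int[lebesgue_measure]_(t in `[0, 1]) slice g x t.

Let take_belast t (x : X) : take m (t :: x) = belast t x.
Proof. by rewrite lastI -cats1 take_size_cat// size_belast size_tuple. Qed.

Let extend_belast g t (x : X) : extend g (take m (t :: x)) = g [tuple of belast t x].
Proof. by rewrite take_belast -(extendE g [tuple of belast t x]). Qed.

Let mseq_cons_tuple : mseq (fun z : measurableTypeR R * X => z.1 :: tval z.2).
Proof.
by apply: mseq_cons => //; apply: (mseq_comp (h := snd)) => //; exact: mseq_tuple.
Qed.

Let measurable_belast g : measurable_fun setT g ->
  measurable_fun setT (fun z : measurableTypeR R * X => g [tuple of belast z.1 z.2]).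
Proof.
move=> mg; under eq_fun do rewrite -extend_belast.
apply/measurable_EFinP; apply: (mfun_seq_comp (mfun_seq_extend mg)).
exact: mseq_take mseq_cons_tuple.
Qed.

Let measurable_slice g : measurable_fun setT g ->
  measurable_fun setT (fun z : measurableTypeR R * X => slice g z.2 z.1).
Proof.
move=> mg; apply: measurable_funM; last exact: measurable_belast.
under eq_fun do rewrite chi_admissible.
apply/measurable_EFinP; apply: (mfun_seq_comp
  (F := fun w => (admissible S w)%:R%:E)) mseq_cons_tuple.
by apply: mfun_seq_order_invariant => ps; exact: order_iso_admissible.
Qed.

Let measurable_slice1 g x : measurable_fun setT g ->
  measurable_fun setT (slice g x : measurableTypeR R -> R).
Proof. by move=> mg; exact: (measurable_fun_pair1 x (measurable_slice mg)). Qed.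

Let uniform_lebesgue (f : measurableTypeR R -> \bar R) : measurable_fun setT f ->
  (\int[lebesgue_measure]_(t in `[0%R, 1%R]) f t = \int[U]_t f t)%E.
Proof.
have pos (f0 : measurableTypeR R -> \bar R) : measurable_fun setT f0 -> (forall t, 0 <= f0 t)%E ->
    (\int[lebesgue_measure]_(t in `[0%R, 1%R]) f0 t = \int[U]_t f0 t)%E.
  by move=> mf f00; rewrite integral_uniform// subr0 invr1 mul1e.
move=> mf; rewrite integralE [RHS]integralE !pos//.
- exact: measurable_funeneg.
- exact: measurable_funepos.
Qed.

Lemma T_realE g x : measurable_fun setT g -> T_real g x = \int[U]_t slice g x t.
Proof.
move=> mg; congr fine; apply: uniform_lebesgue.
by apply/measurable_EFinP; exact: measurable_slice1.
Qed.

(** No integrability is assumed: positive and negative parts are integrated separately, and [fine]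
    is applied to their difference. *)
Lemma measurable_T_real g : measurable_fun setT g -> measurable_fun setT (T_real g).
Proof.
move=> mg.
pose H (z : measurableTypeR R * X) : \bar R := (slice g z.2 z.1)%:E.
have mH : measurable_fun setT H by apply/measurable_EFinP; exact: measurable_slice.
have mp := measurable_fun_fubini_tonelli_G (m1 := U) _ (measurable_funepos mH) (fun z => funepos_ge0 H z).
have mn := measurable_fun_fubini_tonelli_G (m1 := U) _ (measurable_funeneg mH) (fun z => funeneg_ge0 H z).
rewrite (_ : T_real g = fine \o (fubini_G U H^\+ \- fubini_G U H^\-)%E).
  by apply: measurableT_comp => //; exact: emeasurable_funB.
apply/funext => x; rewrite T_realE// /Rintegral integralE /= /fubini_G.
by congr (fine (_ - _)%E); apply: eq_integral => t _; rewrite ?funeposE ?funenegE.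
Qed.

Let int_belast g : measurable_fun setT g -> (forall x, 0 <= g x) ->
  (\int[mu]_x \int[U]_t (g [tuple of belast t x])%:E = \int[mu]_x (g x)%:E)%E.
Proof.
move=> mg g0; have := cube_int_shift m (mfun_seq_extend mg) (fun s => extend_ge0 s g0).
rewrite /cube_int => E; transitivity (\int[mu]_x (extend g x)%:E)%E.
  rewrite -E; apply: eq_integral => x _; apply: eq_integral => t _.
  by rewrite extend_belast.
by apply: eq_integral => x _; rewrite extendE.
Qed.

Let measurable_int_belast g : measurable_fun setT g -> (forall x, 0 <= g x) ->
  measurable_fun setT (fun x : X => \int[U]_t (g [tuple of belast t x])%:E)%E.
Proof.
move=> mg g0; apply: (measurable_fun_fubini_tonelli_G (m1 := U)
  (fun z : measurableTypeR R * X => (g [tuple of belast z.1 z.2])%:E)).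
- by apply/measurable_EFinP; exact: measurable_belast.
- by move=> z; rewrite lee_fin.
Qed.

(** By invariance under the shift, the indicator of a null set has zero integral over almost every
    slice. This makes T well defined up to null sets. *)
Lemma ae_belast (Q : X -> Prop) : {ae mu, forall x, Q x} ->
  {ae mu, forall x : X, {ae U, forall t : R, Q [tuple of belast t x]}}.
Proof.
move=> [N [mN N0 NQ]].
have mI : measurable_fun setT (\1_N : X -> R) by exact: measurable_indic.
have I0 x : 0 <= (\1_N x : R) by rewrite indicE.
have E : (\int[mu]_x \int[U]_t ((\1_N [tuple of belast t x] : R)%:E) = 0)%E.
  by rewrite (int_belast mI I0) integral_indic// setIT; exact: N0.
have := measurable_int_belast mI I0 => mint.
have : (\int[mu]_x `|\int[U]_t (\1_N [tuple of belast t x])%:E| = 0)%E.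
  by rewrite -[RHS]E; apply: eq_integral => x _; rewrite gee0_abs// integral_ge0.
move=> /(ae_eq_integral_abs _ measurableT mint); apply: filterS => x /= /(_ Logic.I) Ex.
have mb : measurable_fun setT (fun t : measurableTypeR R => (\1_N [tuple of belast t x])%:E : \bar R).
  by apply/measurable_EFinP; exact: (measurable_fun_pair1 x (measurable_belast mI)).
have : (\int[U]_t `|(\1_N [tuple of belast t x])%:E| = 0)%E.
  by rewrite -[RHS]Ex; apply: eq_integral => t _; rewrite gee0_abs// lee_fin.
move=> /(ae_eq_integral_abs _ measurableT mb); apply: filterS => t /= /(_ Logic.I).
move=> [] /eqP; rewrite indicE; case: (boolP (_ \in N)) => [_|]; first by rewrite oner_eq0.
by rewrite notin_setE => nN _; apply: contrapT => nQ; apply: nN; exact: NQ.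
Qed.

Let chi01 (w : m.+1.-tuple R) : 0 <= (chi S w : R) <= 1.
Proof. by rewrite chi_admissible; case: (admissible _ _); rewrite ?lexx ler01. Qed.

Let slice_le g x t : `|slice g x t| <= `|g [tuple of belast t x]|.
Proof.
rewrite normrM -[leRHS]mul1r ler_wpM2r//.
by case/andP: (chi01 [tuple of t :: x]) => ? ?; rewrite ger0_norm.
Qed.

(** At the remaining points the slice integral may take a default value, so linearity of T is
    claimed only almost everywhere. *)
Lemma ae_slice_intg g : intg mu g -> {ae mu, forall x, intg U (slice g x)}.
Proof.
move=> gi; have mg := intg_measurable gi; have ngi := intg_norm gi.
have mng := intg_measurable ngi.
have mI := measurable_int_belast mng (fun x => normr_ge0 _).
have : mu.-integrable setT (fun x : X => \int[U]_t (`|g [tuple of belast t x]|)%:E)%E.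
  apply/integrableP; split => //.
  under eq_integral do rewrite gee0_abs ?integral_ge0//.
  rewrite (int_belast mng (fun x => normr_ge0 _)).
  exact: (integrable_lty _ ngi).
move=> /(integrable_ae measurableT); apply: filterS => x /= /(_ Logic.I) fx.
apply/integrableP; split; first by apply/measurable_EFinP; exact: measurable_slice1.
apply: (@le_lt_trans _ _ (\int[U]_t (`|g [tuple of belast t x]|)%:E)%E); last first.
  by rewrite -ge0_fin_numE// integral_ge0.
apply: ge0_le_integral => //.
- apply: measurableT_comp => //; by apply/measurable_EFinP; exact: measurable_slice1.
- by apply/measurable_EFinP; exact: (measurable_fun_pair1 x (measurable_belast mng)).
- by move=> t _; rewrite lee_fin slice_le.
Qed.

Lemma intg_T_real g : intg mu g -> intg mu (T_real g).
Proof.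
move=> gi; have mg := intg_measurable gi; have ngi := intg_norm gi.
have mng := intg_measurable ngi; have n0 x : 0 <= `|g x| by [].
have mT := measurable_T_real mg.
apply/integrableP; split; first exact/measurable_EFinP.
apply: (@le_lt_trans _ _ (\int[mu]_x (`|g x|)%:E)%E); last exact: (integrable_lty _ ngi).
rewrite -(int_belast mng n0); apply: ge0_le_integral => //.
- by apply: measurableT_comp => //; exact/measurable_EFinP.
- exact: (measurable_int_belast mng n0).
move=> x _; rewrite /= T_realE//.
apply: (@le_trans _ _ `|\int[U]_t (slice g x t)%:E|%E).
  (* [fine] sends an infinite integral to 0, so the inequality also holds there. *)
  rewrite /Rintegral; case: (\int[U]_t _)%E => [r||] //=; first by rewrite normr0 leey.
  by rewrite normr0 leey.
apply: le_trans (le_abse_integral _ _ _) _ => //.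
  by apply/measurable_EFinP; exact: measurable_slice1.
apply: ge0_le_integral => //.
- apply: measurableT_comp => //; by apply/measurable_EFinP; exact: measurable_slice1.
- by apply/measurable_EFinP; exact: (measurable_fun_pair1 x (measurable_belast mng)).
- by move=> t _; rewrite lee_fin slice_le.
Qed.

Lemma T_real_ae_eq g h : measurable_fun setT g -> measurable_fun setT h ->
  {ae mu, forall x, g x = h x} -> {ae mu, forall x, T_real g x = T_real h x}.
Proof.
move=> mg mh /ae_belast; apply: filterS => x gh; rewrite !T_realE//.
congr fine; apply: ae_eq_integral => //.
- by apply/measurable_EFinP; exact: measurable_slice1.
- by apply/measurable_EFinP; exact: measurable_slice1.
- by apply: filterS gh => t ght _; rewrite /slice /= ght.
Qed.

Lemma T_real_lin (a b : R) g h : intg mu g -> intg mu h ->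
  {ae mu, forall x, T_real (fun x => a * g x + b * h x) x =
    a * T_real g x + b * T_real h x}.
Proof.
move=> gi hi; have mg := intg_measurable gi; have mh := intg_measurable hi.
have mgh := intg_measurable (intgD (intgZ a gi) (intgZ b hi)).
apply: filterS2 (ae_slice_intg gi) (ae_slice_intg hi) => x sg sh.
rewrite !T_realE// -!RintegralZl// -RintegralD//; [|exact: intgZ|exact: intgZ].
by apply: eq_Rintegral => t _; rewrite /slice; ring.
Qed.

Lemma T_real_ge0 g : measurable_fun setT g -> {ae mu, forall x, 0 <= g x} ->
  {ae mu, forall x, 0 <= T_real g x}.
Proof.
move=> mg g0; have mag : measurable_fun setT (fun x => `|g x|) by exact: measurableT_comp.
have : {ae mu, forall x, g x = `|g x|} by apply: filterS g0 => x g0; rewrite ger0_norm.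
move=> /(T_real_ae_eq mg mag); apply: filterS => x ->.
apply: Rintegral_ge0 => t _; rewrite mulr_ge0//.
by case/andP: (chi01 [tuple of t :: x]).
Qed.

Lemma intg_iter_T_real k g : intg mu g -> intg mu (iter k T_real g).
Proof. by move=> gi; elim: k => //= k IH; exact: intg_T_real. Qed.

Lemma iter_T_real_lin k (a b : R) g h : intg mu g -> intg mu h ->
  {ae mu, forall x, iter k T_real (fun x => a * g x + b * h x) x =
    a * iter k T_real g x + b * iter k T_real h x}.
Proof.
move=> gi hi; have ghi := intgD (intgZ a gi) (intgZ b hi).
elim: k => [|k IH]; first exact: aeW.
have gk := intg_iter_T_real k gi; have hk := intg_iter_T_real k hi.
have E : {ae mu, forall x, T_real (iter k T_real (fun x => a * g x + b * h x)) x =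
   T_real (fun x => a * iter k T_real g x + b * iter k T_real h x) x}.
  apply: T_real_ae_eq => //; apply: intg_measurable.
    exact: intg_iter_T_real.
  exact: (intgD (intgZ a gk) (intgZ b hk)).
by apply: filterS2 E (T_real_lin a b gk hk) => x /= -> ->.
Qed.

(** Finiteness is carried along the induction because real and extended integrals agree only where
    the value is finite. *)
Let iter_T_real_Te k g : intg mu g -> (forall x, 0 <= g x) ->
  {ae mu, forall x : X, iter k (Te S) (fun s => (extend g s)%:E) x \is a fin_num /\
     (iter k T_real g x)%:E = iter k (Te S) (fun s => (extend g s)%:E) x}.
Proof.
move=> gi g0; have mg := intg_measurable gi.
have mE := mfun_seq_extend mg; have E0 s := extend_ge0 s g0.
pose F k := iter k (Te S) (fun s => (extend g s)%:E).
have FP i : [/\ mfun_seq (F i), forall s, (0 <= F i s)%E &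
    (cube_int m (F i) < +oo)%E].
  elim: i => [|i [mF F0 Fi]].
    split => //; rewrite /cube_int; under eq_integral do rewrite /F /= extendE.
    exact: (integrable_lty _ gi).
  split; first exact: mfun_seq_Te.
  - by move=> s; exact: Te_ge0.
  - by apply: le_lt_trans Fi; exact: cube_int_Te_le.
have Ffin i : {ae mu, forall x : X, F i x \is a fin_num}.
  have [mF F0 Fi] := FP i.
  have : mu.-integrable setT (fun x : X => F i x).
    apply/integrableP; split; first exact: mF.
    by under eq_integral do rewrite gee0_abs//.
  by move=> /(integrable_ae measurableT); apply: filterS => x; apply.
elim: k => [|k IH].
  apply: aeW => x /=. by rewrite extendE.
apply: filterS2 (Ffin k.+1) (ae_belast IH) => x fx bx; split => //.
have [mFk F0k _] := FP k.
have mk : measurable_fun setT (iter k T_real g).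
  exact/intg_measurable/intg_iter_T_real.
rewrite [iter k.+1 T_real g x]/= T_realE// -[RHS]fineK//; congr (fine _)%:E.
apply: ae_eq_integral => //.
- by apply/measurable_EFinP; exact: measurable_slice1.
- apply: (mfun_seq_comp (F := fun w => ((admissible S w)%:R%:E * F k (take m w))%E)).
    move=> n; apply: emeasurable_funM.
      by apply: mfun_seq_order_invariant => ps; exact: order_iso_admissible.
    exact: (mfun_seq_take m mFk).
  by apply: mseq_cons => //; exact: mseq_cst.
apply: filterS bx => t [_ tE] _; rewrite /= EFinM tE chi_admissible.
by rewrite take_belast.
Qed.

Lemma iter_T_real_kernel j g : intg mu g ->
  {ae mu, forall x, iter (m + j) T_real g x = kop mu (@kernel R m S j) g x}.
Proof.
move=> gi.
have pos h : intg mu h -> (forall x, 0 <= h x) ->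
    {ae mu, forall x, iter (m + j) T_real h x = kop mu (@kernel R m S j) h x}.
  move=> hi h0; apply: filterS (iter_T_real_Te (m + j) hi h0) => x [_].
  have mE := mfun_seq_extend (intg_measurable hi).
  rewrite (iter_Te_kernel S j mE (fun s => extend_ge0 s h0) (size_tuple x)).
  move=> /(congr1 fine) /= ->; congr fine; apply: eq_integral => t _.
  by rewrite extendE EFinM fineK ?pe_fin.
(* A signed function is written as a difference of two nonnegative integrable ones, to which the
   extended-valued formula applies. *)
pose a x := `|g x|; pose b x := `|g x| - g x.
have ai : intg mu a by exact: intg_norm.
have bi : intg mu b by exact: intgB.
have b0 x : 0 <= b x by rewrite subr_ge0 ler_norm.
have gE : g = fun x => 1 * a x + (-1) * b x by apply/funext => x; rewrite /a /b; ring.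
have mp := @measurable_kernel R m S j; have p01 := @kernel01 R m S j.
apply: filterS3 (iter_T_real_lin (m + j) 1 (-1) ai bi)
  (pos a ai (fun x => normr_ge0 _)) (pos b bi b0) => x.
rewrite -gE => -> -> ->; rewrite mul1r mulN1r -(kopB mp p01)//.
by congr (kop _ _ _ _); apply/funext => y; rewrite /a /b; ring.
Qed.

End TransferOperator.

(** * Spectrum of the transfer operator *)

Section PerronSpectrum.
Context {R : realType} {m : nat} (S : {set 'S_m.+1}) (j : nat).
Local Notation X := (m.-tuple R).
Local Notation mu := (@cube_measure R m).
Local Notation p := (@kernel R m S j).
Local Notation P := (kop mu p).
Local Notation P' := (kop mu (fun x t => p t x)).
Local Notation T := (@T_real R m S).
Local Notation V := (@generic_cube R m).
Implicit Types f g h : X -> R.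

Let mp := @measurable_kernel R m S j.
Let p01 := @kernel01 R m S j.

Hypothesis m_gt0 : (0 < m)%N.
Hypothesis paths : forall x y : @H_vertex R m, exists z, [/\ size z = j,
  {in z, forall t, 0 < t < 1} & good S (m + j) (sval x ++ z ++ sval y)].
Variable v : @H_vertex R m.

Let aeV : {ae mu, forall x, V x}. Proof. exact: ae_generic_cube. Qed.

Let p_gt0 t x : V t -> V x -> 0 < p t x. Proof. exact: kernel_gt0. Qed.

Lemma perron_pair : exists (rho C : R) (phi psi : X -> R), 0 < rho /\
  [/\ measurable_fun setT phi, forall x, `|phi x| <= C,
      {ae mu, forall x, 0 < phi x} & {ae mu, forall x, P phi x = rho * phi x}] /\
  [/\ measurable_fun setT psi, forall x, `|psi x| <= C,
      {ae mu, forall x, 0 < psi x} & {ae mu, forall x, P' psi x = rho * psi x}].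
Proof.
have mpT : measurable_fun setT (fun z : X * X => p z.2 z.1).
  exact: (measurableT_comp mp (@measurable_swap _ _ X X)).
have pT01 (x t : X) : 0 <= p t x <= 1 by [].
have [u [delta [mu_ u01 uv d0 [Pu P'u]]]] := kernel_minorization paths v.
have [D sepD] := @kop_separable R m S j.
have [D' sepD'] := @kop_adjoint_separable R m S j.
have [rho [C [phi [rho0 mphi phiC phi1 Pphi]]]] :=
  perron_eigenfunction mp p01 mu_ u01 uv d0 Pu aeV sepD.
have [rho' [C' [psi [rho'0 mpsi psiC psi1 Ppsi]]]] :=
  perron_eigenfunction mpT pT01 mu_ u01 uv d0 P'u aeV sepD'.
have nz f : \int[mu]_x f x = 1 -> measurable_fun setT f -> ~ {ae mu, forall x, f x = 0}.
  move=> f1 mf f0; have := Rintegral_ae_eq (intg_cst mu (0 : R)) mf.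
  rewrite f1 Rintegral_const => H; have : (0 : R) = 1.
    by apply: H; apply: filterS f0 => x ->.
  by move/eqP; rewrite eq_sym oner_eq0.
have abs f (M : R) : (forall x, 0 <= f x <= M) -> forall x, `|f x| <= M.
  by move=> fM x; case/andP: (fM x) => ? ?; rewrite ger0_norm.
have phii : intg mu phi by exact: (@bounded_intg _ _ _ mu phi C mphi (abs _ _ phiC)).
have psii : intg mu psi by exact: (@bounded_intg _ _ _ mu psi C' mpsi (abs _ _ psiC)).
have phi_ge0 : {ae mu, forall x, 0 <= phi x} by apply: aeW => x; case/andP: (phiC x).
have psi_ge0 : {ae mu, forall x, 0 <= psi x} by apply: aeW => x; case/andP: (psiC x).
have phi_gt0 : {ae mu, forall x, 0 < phi x}.
  exact: (eigenfunction_gt0 mp p01 aeV p_gt0 rho0 phii phi_ge0 (nz _ phi1 mphi) Pphi).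
have psi_gt0 : {ae mu, forall x, 0 < psi x}.
  apply: (eigenfunction_gt0 mpT pT01 aeV _ rho'0 psii psi_ge0 (nz _ psi1 mpsi) Ppsi).
  by move=> t x ? ?; exact: p_gt0.
have pair0 := pair_gt0 mpsi (abs _ _ psiC) psi_gt0 phii phi_ge0 (nz _ phi1 mphi).
have E := pair_kop mp p01 mpsi (abs _ _ psiC) Ppsi phii.
(* Both eigenvalues multiply the positive pairing of [phi] and [psi] to the same integral. *)
have rr : rho = rho'.
  apply: (mulIf (lt0r_neq0 pair0)); rewrite -E -RintegralZl//.
    apply: Rintegral_ae_eq.
    - have := intgZ rho (intgM_bounded mpsi (abs _ _ psiC) phii).
      rewrite (_ : (fun x => rho * (psi x * phi x)) = (fun x => rho * (phi x * psi x)))//.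
      by apply/funext => x; rewrite (mulrC (psi x)).
    - by apply: measurable_funM => //; exact: measurable_kop.
    - by apply: filterS Pphi => x ->; rewrite mulrA.
  have := intgM_bounded mpsi (abs _ _ psiC) phii.
  rewrite (_ : (fun x => psi x * phi x) = (fun x => phi x * psi x))//.
  by apply/funext => x; rewrite mulrC.
exists rho, (Num.max C C'), phi, psi; split => //; split; split => //.
- by move=> x; rewrite le_max (abs _ _ phiC).
- by move=> x; rewrite le_max (abs _ _ psiC) orbT.
- by rewrite rr.
Qed.

Variables (rho C : R) (phi psi : X -> R).
Hypotheses (rho_gt0 : 0 < rho) (mphi : measurable_fun setT phi).
Hypothesis phi_bd : forall x, `|phi x| <= C.
Hypothesis phi_gt0 : {ae mu, forall x, 0 < phi x}.
Hypothesis Pphi : {ae mu, forall x, P phi x = rho * phi x}.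
Hypotheses (mpsi : measurable_fun setT psi) (psi_bd : forall x, `|psi x| <= C).
Hypothesis psi_gt0 : {ae mu, forall x, 0 < psi x}.
Hypothesis Ppsi : {ae mu, forall x, P' psi x = rho * psi x}.

Let phi_int : intg mu phi. Proof. exact: (@bounded_intg _ _ _ mu phi C mphi phi_bd). Qed.

Let line g : intg mu g -> {ae mu, forall x, P g x = rho * g x} ->
  exists c : R, {ae mu, forall x, g x = c * phi x}.
Proof. exact: (eigenspace_line mp p01 aeV p_gt0 rho_gt0 phi_int phi_gt0 Pphi mpsi psi_bd psi_gt0 Ppsi). Qed.

Let iterP g : intg mu g -> {ae mu, forall x, iter (m + j) T g x = P g x}.
Proof. exact: iter_T_real_kernel. Qed.

Let T_sub g (a b : R) h k : intg mu g -> intg mu h -> intg mu k ->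
  {ae mu, forall x, g x = a * h x + b * k x} ->
  {ae mu, forall x, T g x = a * T h x + b * T k x}.
Proof.
move=> gi hi ki E; have hki := intgD (intgZ a hi) (intgZ b ki).
have E1 := T_real_ae_eq S (intg_measurable gi) (intg_measurable hki) E.
by apply: filterS2 E1 (T_real_lin S a b hi ki) => x -> ->.
Qed.

(** T commutes with P = T^(m+j), so T phi lies on the eigenline of [phi]; positivity of T makes the
    factor nonnegative, and iteration identifies its power as [rho]. *)
Lemma T_phi : exists r : R, [/\ 0 < r, r ^+ (m + j) = rho &
  {ae mu, forall x, T phi x = r * phi x}].
Proof.
have Ti := intg_T_real S phi_int.
have Ki := intg_kop mp p01 phi_int.
have ITi := intg_iter_T_real S (m + j) phi_int.
have E : {ae mu, forall x, P (T phi) x = rho * T phi x}.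
  have E1 := iterP Ti; have E2 := iterP phi_int.
  (* The vanishing second term gives the two-term shape that [T_sub] expects. *)
  have E3 : {ae mu, forall x, iter (m + j) T phi x = rho * phi x + 0 * phi x}.
    by apply: filterS2 E2 Pphi => x -> ->; rewrite mul0r addr0.
  apply: filterS2 E1 (T_sub ITi phi_int phi_int E3) => x <-.
  by rewrite -iterSr iterS => ->; rewrite mul0r addr0.
have [r Tr] := line Ti E; exists r.
have [x [[phx Tx] T0]] : exists x, (0 < phi x /\ T phi x = r * phi x) /\ 0 <= T phi x.
  apply: ae_exists; apply: filterI (filterI phi_gt0 Tr) _.
  by apply: T_real_ge0 => //; apply: filterS phi_gt0 => x /ltW.
have r0 : 0 <= r by rewrite -(pmulr_lge0 _ phx) -Tx.
have IT k : {ae mu, forall x, iter k T phi x = r ^+ k * phi x}.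
  elim: k => [|k IH]; first by apply: aeW => y; rewrite expr0 mul1r.
  have IH' : {ae mu, forall x, iter k T phi x = r ^+ k * phi x + 0 * phi x}.
    by apply: filterS IH => y ->; rewrite mul0r addr0.
  apply: filterS2 Tr (T_sub (intg_iter_T_real S k phi_int) phi_int phi_int IH') => y Ty.
  by rewrite iterS => ->; rewrite Ty mul0r addr0 exprSr mulrA.
have rN : r ^+ (m + j) = rho.
  have [y [[y1 y2] [y3 y4]]] : exists y, (iter (m + j) T phi y = P phi y /\
      P phi y = rho * phi y) /\ (iter (m + j) T phi y = r ^+ (m + j) * phi y /\ 0 < phi y).
    apply: ae_exists; exact: (filterI (filterI (iterP phi_int) Pphi) (filterI (IT (m + j)%N) phi_gt0)).
  by apply: (mulIf (lt0r_neq0 y4)); rewrite -y2 -y1 y3.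
split=> //; rewrite lt_neqAle r0 andbT; apply: contraTneq rho_gt0 => r0'.
by rewrite -rN -r0' expr0n addn_eq0 (gtn_eqF m_gt0) ltxx.
Qed.

Variable r : R.
Hypotheses (r_gt0 : 0 < r) (rN : r ^+ (m + j) = rho).
Hypothesis Tphi : {ae mu, forall x, T phi x = r * phi x}.

Lemma T_real_eigenspace g : intg mu g -> {ae mu, forall x, T g x = r * g x} ->
  exists c : R, {ae mu, forall x, g x = c * phi x}.
Proof.
move=> gi Tg; apply: line => //.
have IT k : {ae mu, forall x, iter k T g x = r ^+ k * g x}.
  elim: k => [|k IH]; first by apply: aeW => y; rewrite expr0 mul1r.
  have IH' : {ae mu, forall x, iter k T g x = r ^+ k * g x + 0 * g x}.
    by apply: filterS IH => y ->; rewrite mul0r addr0.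
  apply: filterS2 Tg (T_sub (intg_iter_T_real S k gi) gi gi IH') => y Ty.
  by rewrite iterS => ->; rewrite Ty mul0r addr0 exprSr mulrA.
by apply: filterS2 (IT (m + j)%N) (iterP gi) => x -> <-; rewrite rN.
Qed.

(* A Jordan block [T g = r g + c phi] with [c <> 0] is ruled out by pairing
   [P g = T^(m+j) g] with [psi]. *)
Let no_jordan g (c : R) : intg mu g ->
  {ae mu, forall x, T g x = r * g x + c * phi x} -> c = 0.
Proof.
move=> gi Tg.
(* Here d = k r^(k-1), which is positive as soon as k > 0. *)
have H k : exists d : R, [/\ 0 <= d, (0 < k)%N -> 0 < d &
    {ae mu, forall x, iter k T g x = r ^+ k * g x + d * c * phi x}].
  elim: k => [|k [d [d0 _ IH]]].
    by exists 0; split => //; apply: aeW => x; rewrite !mul0r addr0 mul1r.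
  exists (r ^+ k + d * r).
  have rk : 0 < r ^+ k by exact: exprn_gt0.
  have dr : 0 <= d * r by rewrite mulr_ge0// ltW.
  split; [by rewrite addr_ge0// ltW|by rewrite ltr_pwDl|].
  apply: filterS3 Tg Tphi (T_sub (intg_iter_T_real S k gi) gi phi_int IH) => x Tgx Tpx.
  by rewrite iterS => ->; rewrite Tgx Tpx exprS; ring.
have [d [_ dpos dE]] := H (m + j)%N.
have d0 : 0 < d by apply: dpos; rewrite addn_gt0 m_gt0.
have PE : {ae mu, forall x, P g x = rho * g x + d * c * phi x}.
  by apply: filterS2 dE (iterP gi) => x -> <-; rewrite rN.
have bi f : intg mu f -> intg mu (fun x => f x * psi x).
  move=> fi; have := intgM_bounded mpsi psi_bd fi.
  by rewrite (_ : (fun x => psi x * f x) = (fun x => f x * psi x))//;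
    apply/funext => x; rewrite mulrC.
have E := pair_kop mp p01 mpsi psi_bd Ppsi gi.
have phi0 : {ae mu, forall x, 0 <= phi x} by apply: filterS phi_gt0 => x /ltW.
have pos := pair_gt0 mpsi psi_bd psi_gt0 phi_int phi0 (not_ae_eq0_gt0 phi_gt0).
have : rho * \int[mu]_x (g x * psi x) + d * c * \int[mu]_x (phi x * psi x) =
    rho * \int[mu]_x (g x * psi x).
  rewrite -[RHS]E -!RintegralZl//; try exact: bi.
  rewrite -RintegralD//; [|exact: intgZ (bi _ _)|exact: intgZ (bi _ _)].
  apply/esym; apply: Rintegral_ae_eq.
  - exact/bi/intg_kop.
  - apply: intg_measurable; exact: intgD (intgZ _ (bi _ _)) (intgZ _ (bi _ _)).
  - by apply: filterS PE => x ->; rewrite mulrDl !mulrA.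
move=> /eqP; rewrite -subr_eq0 addrAC subrr add0r !mulf_eq0.
by rewrite (gt_eqF d0) (gt_eqF pos) /= orbF => /eqP.
Qed.

(** By induction (T - r) g is a multiple of [phi], and [no_jordan] makes that multiple zero. *)
Lemma T_real_generalized k g : intg mu g ->
  {ae mu, forall x, iter k (fun h x => T h x - r * h x) g x = 0} ->
  exists c : R, {ae mu, forall x, g x = c * phi x}.
Proof.
elim: k g => [|k IH] g gi; first by move=> g0; exists 0; apply: filterS g0 => x; rewrite mul0r.
rewrite iterSr => H; have Bi : intg mu (fun x => T g x - r * g x).
  exact: (intgB (intg_T_real S gi) (intgZ r gi)).
have [c Bc] := IH _ Bi H.
have Tg : {ae mu, forall x, T g x = r * g x + c * phi x}.
  by apply: filterS Bc => x <-; rewrite addrC subrK.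
have c0 := no_jordan gi Tg; apply: T_real_eigenspace => //.
by apply: filterS Tg => x ->; rewrite c0 mul0r addr0.
Qed.

(** * Complex eigenvalues of T *)

Section ComplexEigenvalue.
Variables (a b : X -> R) (lam : R[i]).
Hypotheses (ai : intg mu a) (bi : intg mu b).
Local Notation Re := complex.Re.
Local Notation Im := complex.Im.
Hypothesis Ta : {ae mu, forall x, T a x = Re lam * a x - Im lam * b x}.
Hypothesis Tb : {ae mu, forall x, T b x = Im lam * a x + Re lam * b x}.
Hypothesis ab0 : ~ {ae mu, forall x, a x = 0 /\ b x = 0}.

Let iter_ab k :
  {ae mu, forall x, iter k T a x = Re (lam ^+ k) * a x - Im (lam ^+ k) * b x} /\
  {ae mu, forall x, iter k T b x = Im (lam ^+ k) * a x + Re (lam ^+ k) * b x}.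
Proof.
elim: k => [|k [IHa IHb]].
  by split; apply: aeW => x; rewrite expr0 /= mul1r mul0r ?subr0 ?add0r.
have eRe (z : R[i]) : Re (z * lam ^+ k) = Re z * Re (lam ^+ k) - Im z * Im (lam ^+ k).
  by case: z; case: (lam ^+ k).
have eIm (z : R[i]) : Im (z * lam ^+ k) = Re z * Im (lam ^+ k) + Im z * Re (lam ^+ k).
  by case: z; case: (lam ^+ k).
have IHa' : {ae mu, forall x, iter k T a x = Re (lam ^+ k) * a x + - Im (lam ^+ k) * b x}.
  by apply: filterS IHa => x ->; rewrite mulNr.
split.
  apply: filterS3 Ta Tb (T_sub (intg_iter_T_real S k ai) ai bi IHa') => x Tax Tbx.
  by rewrite iterS => ->; rewrite Tax Tbx exprS eRe eIm; ring.
apply: filterS3 Ta Tb (T_sub (intg_iter_T_real S k bi) ai bi IHb) => x Tax Tbx.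
by rewrite iterS => ->; rewrite Tax Tbx exprS eRe eIm; ring.
Qed.

Let Pa : {ae mu, forall x, P a x = Re (lam ^+ (m + j)) * a x - Im (lam ^+ (m + j)) * b x}.
Proof. by have [H _] := iter_ab (m + j); apply: filterS2 H (iterP ai) => x -> <-. Qed.

Let Pb : {ae mu, forall x, P b x = Im (lam ^+ (m + j)) * a x + Re (lam ^+ (m + j)) * b x}.
Proof. by have [_ H] := iter_ab (m + j); apply: filterS2 H (iterP bi) => x -> <-. Qed.

Let N_gt0 : (0 < m + j)%N. Proof. by rewrite addn_gt0 m_gt0. Qed.

Let rNC : rho%:C = r%:C ^+ (m + j) :> R[i]. Proof. by rewrite -rN rmorphXn. Qed.

Lemma T_eigenvalue_le : `|lam| <= r%:C.
Proof.
have r0 : 0 <= r%:C :> R[i] by rewrite ler0c ltW.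
rewrite -(ler_pXn2r N_gt0) ?nnegrE//.
rewrite -normrX -rNC normc_def lecR.
exact: (eigenvalue_norm_le mp p01 mpsi psi_bd psi_gt0 Ppsi ai bi Pa Pb ab0).
Qed.

(** The kernel operator alone yields only lam^(m+j) = rho. It also places [a] and [b] on the line of
    [phi], where T acts as r, and this singles out the root. *)
Lemma T_eigenvalue_eq : `|lam| = r%:C -> lam = r%:C.
Proof.
move=> lr; have : `|lam ^+ (m + j)| = rho%:C by rewrite normrX lr rNC.
rewrite normc_def => /complexI nr.
have [e1 e2] := eigenvalue_norm_eq mp p01 aeV p_gt0 mpsi psi_bd psi_gt0 Ppsi ai bi Pa Pb ab0 nr.
have eig f : intg mu f -> {ae mu, forall x, P f x = rho * f x} ->
    {ae mu, forall x, T f x = r * f x}.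
  move=> fi Pf; have [c cE] := line fi Pf.
  have cE' : {ae mu, forall x, f x = c * phi x + 0 * phi x}.
    by apply: filterS cE => x ->; rewrite mul0r addr0.
  apply: filterS3 cE Tphi (T_sub fi phi_int phi_int cE') => x -> Tx ->.
  by rewrite Tx; ring.
have Ta' : {ae mu, forall x, T a x = r * a x}.
  by apply: eig => //; apply: filterS Pa => x ->; rewrite e1 e2 mul0r subr0.
have Tb' : {ae mu, forall x, T b x = r * b x}.
  by apply: eig => //; apply: filterS Pb => x ->; rewrite e1 e2 mul0r add0r.
have H : {ae mu, forall x, (Re lam - r) * (a x ^+ 2 + b x ^+ 2) = 0 /\
    Im lam * (a x ^+ 2 + b x ^+ 2) = 0}.
  apply: filterS2 (filterI Ta Ta') (filterI Tb Tb') => x [A1 A2] [B1 B2].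
  have A3 : (Re lam - r) * a x - Im lam * b x = 0 by rewrite mulrBl -A2 A1; ring.
  have B3 : Im lam * a x + (Re lam - r) * b x = 0 by rewrite mulrBl -B2 B1; ring.
  split.
    transitivity (a x * ((Re lam - r) * a x - Im lam * b x) +
      b x * (Im lam * a x + (Re lam - r) * b x)); first by ring.
    by rewrite A3 B3 !mulr0 addr0.
  transitivity (a x * (Im lam * a x + (Re lam - r) * b x) -
    b x * ((Re lam - r) * a x - Im lam * b x)); first by ring.
  by rewrite A3 B3 !mulr0 subr0.
have sq0 x : a x ^+ 2 + b x ^+ 2 = 0 -> a x = 0 /\ b x = 0.
  move=> /eqP; rewrite paddr_eq0 ?sqr_ge0// !expf_eq0 /= => /andP[/eqP -> /eqP ->].
  by [].
have [z1|z1] := eqVneq (Re lam - r) 0; last first.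
  exfalso; apply: ab0; apply: filterS H => x [/eqP + _].
  by rewrite mulf_eq0 (negPf z1) /= => /eqP /sq0.
have [z2|z2] := eqVneq (Im lam) 0; last first.
  exfalso; apply: ab0; apply: filterS H => x [_ /eqP].
  by rewrite mulf_eq0 (negPf z2) /= => /eqP /sq0.
move: z1 z2; case: lam => /= l1 l2 /eqP; rewrite subr_eq0 => /eqP -> ->.
by [].
Qed.

End ComplexEigenvalue.

End PerronSpectrum.

(** * Square-integrable functions on a probability space *)

Section SquareIntegrable.
Context d (X : measurableType d) (R : realType) (mu : probability X R).
Implicit Types f : X -> R.

Lemma Lfun2_intg f : f \in Lfun mu 2%:E -> intg mu f.
Proof.
move=> f2; apply/Lfun1_integrable; apply: Lfun_subset12 f2.
exact: fin_num_measure.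
Qed.

Lemma bounded_Lfun2 f (C : R) : measurable_fun setT f -> (forall x, `|f x| <= C) ->
  f \in Lfun mu 2%:E.
Proof.
move=> mf fC; rewrite inE; apply/andP; split; rewrite inE//=.
rewrite /finite_norm unlock /Lnorm poweR_lty//.
rewrite -[X in (X < _)%E]/(\int[mu]_x (`|f x| `^ 2)%:E)%E.
apply: (@le_lt_trans _ _ (\int[mu]_x (C `^ 2)%:E)%E); last first.
  exact: (integrable_lty _ (intg_cst mu (C `^ 2))).
apply: ge0_le_integral => //.
- apply/measurable_EFinP; apply: (@measurableT_comp _ _ _ _ _ _ (fun x : R => x `^ 2)) => //.
  exact: measurableT_comp.
- move=> x _; rewrite lee_fin; apply: ge0_ler_powR => //; rewrite nnegrE//.
  exact: le_trans (fC x).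
Qed.

End SquareIntegrable.

(** * Real and imaginary parts of the complex operator *)

Section ComplexTransfer.
Context {R : realType} {m : nat} (S : {set 'S_m.+1}).
Local Notation X := (m.-tuple R).
Local Notation Re := complex.Re.
Local Notation Im := complex.Im.

Lemma iter_T_op k (f : X -> R[i]) : iter k (@T_op R m S) f =
  fun x => iter k (@T_real R m S) (fun x => Re (f x)) x +i*
           iter k (@T_real R m S) (fun x => Im (f x)) x.
Proof.
elim: k => [|k IH]; first by apply/funext => x /=; case: (f x).
by rewrite iterS IH.
Qed.

Lemma iter_T_op_sub k (r : R) (f : X -> R[i]) :
  iter k (fun g x => @T_op R m S g x - r%:C * g x) f =
  fun x => iter k (fun h x => @T_real R m S h x - r * h x) (fun x => Re (f x)) x +i*
           iter k (fun h x => @T_real R m S h x - r * h x) (fun x => Im (f x)) x.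
Proof.
elim: k => [|k IH]; first by apply/funext => x /=; case: (f x).
rewrite iterS IH; apply/funext => x; rewrite !iterS.
by rewrite /T_op /T_real /slice /=; simpc.
Qed.

Lemma T_real0 x : @T_real R m S (fun=> 0) x = 0.
Proof.
rewrite /T_real /Rintegral integral0_eq// => t _; by rewrite /slice mulr0.
Qed.

End ComplexTransfer.

Theorem theorem1p7 (R : realType) (m : nat) (S : {set 'S_m.+1})
    (m_ge2 : (2 <= m)%N) (H_ergodic : ergodic (@H_edge R m S)) :
  let T := @T_op R m S in
  let mu := @cube_measure R m in
  positivity_improving mu T /\
  exists r : R,
    [/\ unique (eigenvalue_of_largest_modulus mu T) r%:C,
        simple_eigenvalue mu T r%:C,
        0 < r &
        exists2 phi, is_eigenfunction mu T r%:C phi &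
          {ae mu, forall x, 0 < phi x}].
Proof.
move=> T mu; have m_gt0 : (0 < m)%N by exact: ltnW.
have [v _] := H_ergodic.2.
have [j paths] := uniform_good m_gt0 H_ergodic.
have mp := @measurable_kernel R m S j; have p01 := @kernel01 R m S j.
have L2_intg (f : m.-tuple R -> R[i]) : L2 mu f ->
    intg mu (fun x => complex.Re (f x)) /\ intg mu (fun x => complex.Im (f x)).
  by move=> [f1 f2]; split; exact: Lfun2_intg.
have intg0 : intg mu (fun=> 0) by exact: intg_cst.
have complex0 (f : m.-tuple R -> R[i]) : ~ ae_zero mu f ->
    ~ {ae mu, forall x, complex.Re (f x) = 0 /\ complex.Im (f x) = 0}.
  by move=> f0 H; apply: f0; apply: filterS H => x; case: (f x) => a b /= [-> ->].
split.
  move=> f fL2 f_ge0 fn0; exists (m + j)%N; first by rewrite addn_gt0 m_gt0.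
  have [ai bi] := L2_intg f fL2.
  have b0 : {ae mu, forall x, complex.Im (f x) = 0}.
    by apply: filterS f_ge0 => x; rewrite lecE => /andP[/eqP].
  have a0 : {ae mu, forall x, 0 <= complex.Re (f x)}.
    by apply: filterS f_ge0 => x; rewrite lecE => /andP[].
  have an0 : ~ {ae mu, forall x, complex.Re (f x) = 0}.
    by move=> H; apply: (complex0 f fn0); exact: filterS2 H b0.
  rewrite /T iter_T_op.
  apply: filterS3 (iter_T_real_kernel S j ai) (iter_T_real_kernel S j bi)
    (ae_generic_cube) => x -> -> Vx.
  (* Positivity in the complex order has two halves: the imaginary part vanishes, being the kernel
     operator applied to an almost everywhere zero function, and the real part is positive. *)
  rewrite ltcE /= (kop_ae_eq mp p01 x bi intg0 b0) /kop.
  under eq_Rintegral do rewrite mulr0.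
  rewrite Rintegral_const eqxx /=.
  exact: (kop_improving mp p01 (@ae_generic_cube R m) (kernel_gt0 paths) ai a0 an0 Vx).
have [rho [C [phi [psi [rho_gt0 [[mphi phi_bd phi_gt0 Pphi] [mpsi psi_bd psi_gt0 Ppsi]]]]]]] :=
  perron_pair paths v.
have [r [r_gt0 rN Tphi]] := T_phi m_gt0 paths rho_gt0 mphi phi_bd phi_gt0 Pphi
  mpsi psi_bd psi_gt0 Ppsi.
have phi_eig : is_eigenfunction mu T r%:C (fun x => (phi x)%:C).
  split.
  - split; first exact: (@bounded_Lfun2 _ _ _ mu phi C mphi phi_bd).
    by apply: (@bounded_Lfun2 _ _ _ mu (fun=> 0) 0) => // x; rewrite normr0.
  - move=> H; apply: (not_ae_eq0_gt0 phi_gt0); apply: filterS H => x.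
    by move=> /complexI.
  - apply: filterS Tphi => x Tx; rewrite /T /T_op.
    rewrite -[X in X +i* _]/(T_real S phi x) -[X in _ +i* X]/(T_real S (fun=> 0) x).
    by rewrite Tx T_real0; simpc.
have eig_real lam (f : m.-tuple R -> R[i]) : is_eigenfunction mu T lam f ->
    {ae mu, forall x, T_real S (fun x => complex.Re (f x)) x =
      complex.Re lam * complex.Re (f x) - complex.Im lam * complex.Im (f x)} /\
    {ae mu, forall x, T_real S (fun x => complex.Im (f x)) x =
      complex.Im lam * complex.Re (f x) + complex.Re lam * complex.Im (f x)}.
  move=> [_ _ Tf]; split; apply: filterS Tf => x; rewrite /T /T_op.
    move=> E; transitivity (complex.Re (lam * f x)); first by rewrite -E.
    by case: lam (f x) {E} => [l1 l2] [a b].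
  move=> E; transitivity (complex.Im (lam * f x)); first by rewrite -E.
  by case: lam (f x) {E} => [l1 l2] [a b] /=; rewrite addrC.
have eig_le nu : is_eigenvalue mu T nu -> `|nu| <= r%:C /\ (`|nu| = r%:C -> nu = r%:C).
  move=> [f fe]; have [Ta Tb] := eig_real nu f fe.
  have [fL2 fn0 _] := fe; have [ai bi] := L2_intg f fL2.
  split.
    exact: (T_eigenvalue_le m_gt0 mpsi psi_bd psi_gt0 Ppsi r_gt0 rN ai bi Ta Tb (complex0 f fn0)).
  exact: (T_eigenvalue_eq paths rho_gt0 mphi phi_bd phi_gt0 Pphi mpsi psi_bd psi_gt0 Ppsi
    rN Tphi ai bi Ta Tb (complex0 f fn0)).
have nr : `|r%:C| = r%:C :> R[i] by rewrite ger0_norm// ler0c ltW.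
exists r; split => //.
- split.
    split; first by exists (fun x => (phi x)%:C).
    by move=> nu /eig_le[]; rewrite nr.
  (* A second eigenvalue of largest modulus has modulus exactly r, so the equality case identifies
     it with r. *)
  move=> nu [nue numax]; have [nu_le nu_eq] := eig_le nu nue.
  apply/esym/nu_eq/eqP; rewrite eq_le nu_le /= -nr; apply: numax.
  by exists (fun x => (phi x)%:C).
- exists (fun x => (phi x)%:C) => // f [fL2 [k]].
  rewrite /T iter_T_op_sub => f0; have [ai bi] := L2_intg f fL2.
  have gen h : intg mu h ->
      {ae mu, forall x, iter k (fun h x => T_real S h x - r * h x) h x = 0} ->
      exists c : R, {ae mu, forall x, h x = c * phi x}.
    exact: (T_real_generalized m_gt0 paths rho_gt0 mphi phi_bd phi_gt0 Pphi mpsi psi_bd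
      psi_gt0 Ppsi r_gt0 rN Tphi).
  have [c1 E1] : exists c : R, {ae mu, forall x, complex.Re (f x) = c * phi x}.
    by apply: gen ai _; apply: filterS f0 => x [].
  have [c2 E2] : exists c : R, {ae mu, forall x, complex.Im (f x) = c * phi x}.
    by apply: gen bi _; apply: filterS f0 => x [].
  exists (c1 +i* c2); apply: filterS2 E1 E2 => x; case: (f x) => a b /= -> ->.
  by simpc.
- exists (fun x => (phi x)%:C) => //.
  by apply: filterS phi_gt0 => x; rewrite ltcE /= eqxx.
Qed.
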